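(* Let $\tau$ be a zigzag type, let $\mathbb X:\mathcal P_\tau\to\mathbf{top}$ be a topological diagram, and let $k_1$ and $k_2$ be fields. Then $$\mathrm{Bar}(H_0(\mathbb X;k_1))=\mathrm{Bar}(H_0(\mathbb X;k_2)).$$
   Context: A zigzag type $\tau$ of length $n=|\tau|$ is a directed graph on vertices $\{1,\dots,n\}$ with exactly one edge, in one of the two directions, between $i$ and $i+1$ for each $1\le i<n$. $\mathcal P_\tau$ is its path category: objects $1,\dots,n$, with a unique morphism $i\to j$ if and only if there is a directed path (possibly trivial) from $i$ to $j$ in $\tau$. $\mathbf{top}$ is the category of topological spaces whose singular homology groups are finitely generated in every degree, with continuous maps. A topological diagram over $\tau$ is a functor $\mathbb X:\mathcal P_\tau\to\mathbf{top}$. For a field $k$, $H_0(\mathbb X;k)$ is the functor $H_0(-;k)\circ\mathbb X:\mathcal P_\tau\to\mathbf{vect}_k$, where $H_0(-;k)$ is singular homology in degree $0$ and $\mathbf{vect}_k$ is the category of finite-dimensional $k$-vector spaces. A functor $\mathbb V:\mathcal P_\tau\to\mathbf{vect}_k$ is a zigzag module of type $\tau$. The interval module $\mathbb I_\tau\langle b,d\rangle$ ($1\le b\le d\le n$) is $k$ at indices $b\le i\le d$ and $0$ otherwise, with identity maps between adjacent copies of $k$ and zero maps otherwise. Every zigzag module is isomorphic to a finite direct sum $\bigoplus_j\mathbb I_\tau\langle b_j,d_j\rangle$, uniquely up to reordering; its barcode $\mathrm{Bar}(\mathbb V)$ is the multiset of pairs $\langle b_j,d_j\rangle$, and barcodes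 are equal if they coincide as multisets. *)

(* Defs.v *)
From HB Require Import structures.
From mathcomp Require Import freeg.
From mathcomp Require Import all_boot all_order all_algebra.
From mathcomp Require Import finmap multiset zify.
From mathcomp Require Import all_classical reals topology normedtype.

Set Implicit Arguments.
Unset Strict Implicit.
Unset Printing Implicit Defensive.

Import Order.TTheory GRing.Theory Num.Theory.
Import numFieldNormedType.Exports.

Local Open Scope classical_set_scope.
Local Open Scope ring_scope.

(* Over [int] this is finite generation of an abelian group, over a field it is
   finite dimension. *)
Definition fin_gen (A : pzRingType) (V : lmodType A) : Prop :=
  exists m (g : 'I_m -> V), forall v : V,
    exists a : 'I_m -> A, v = \sum_(l < m) a l *: g l.

Lemma fin_gen_finType (A : pzRingType) (V : lmodType A) (I : finType)
    (g : I -> V) :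
  (forall v, exists a : I -> A, v = \sum_i a i *: g i) -> fin_gen V.
Proof.
move=> gen; exists #|I|, (g \o enum_val) => v.
have [a ->] := gen v; exists (a \o enum_val).
by rewrite (reindex (@enum_val I predT)) //; exact/onW_bij/enum_val_bij.
Qed.

Section Homology.
Variables (A : pzRingType) (C2 C1 C0 : lmodType A).
Variables (d2 : {linear C2 -> C1}) (d1 : {linear C1 -> C0}).

Definition hcycles : {pred C1} := fun c => d1 c == 0.

Fact hcycles_submod : submod_closed hcycles.
Proof.
split=> [|a x y]; rewrite !unfold_in ?linear0 //.
by move=> /eqP x0 /eqP y0; rewrite linearP x0 y0 scaler0 addr0.
Qed.
HB.instance Definition _ := GRing.isSubmodClosed.Build A C1 hcycles hcycles_submod.

Record hcycle := Hcycle { hcycle_val : C1; hcycle_valP : hcycle_val \in hcycles }.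
HB.instance Definition _ := [isSub for hcycle_val].
HB.instance Definition _ := [Choice of hcycle by <:].
HB.instance Definition _ := [SubChoice_isSubLmodule of hcycle by <:].

(* Boundaries are taken inside the cycles, so that [d1 \o d2 = 0] need not be
   assumed in order to form the quotient. *)
Definition hboundaries : {pred hcycle} :=
  fun z => `[< exists c : C2, hcycle_val z = d2 c >].

Fact hboundaries_zmod : zmod_closed hboundaries.
Proof.
split=> [|x y]; first by apply/asboolP; exists 0; rewrite linear0.
move=> /asboolP[c xc] /asboolP[e ye]; apply/asboolP; exists (c - e).
by rewrite linearB -xc -ye.
Qed.
HB.instance Definition _ := GRing.isZmodClosed.Build hcycle hboundaries
  hboundaries_zmod.

Definition homology := Quotient.quot hboundaries.
HB.instance Definition _ := Choice.on homology.
HB.instance Definition _ := GRing.Zmodule.on homology.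

Definition hclass (z : hcycle) : homology :=
  (\pi_(Quotient.quot hboundaries) z)%qT.

Lemma hclassP (x y : hcycle) :
  hclass x = hclass y <-> exists c, hcycle_val x - hcycle_val y = d2 c.
Proof.
split=> [/eqP|xy].
  by rewrite -Quotient.idealrBE => /asboolP.
by apply/eqP; rewrite -Quotient.idealrBE; apply/asboolP.
Qed.

Definition hrepr (u : homology) : hcycle :=
  repr (u : Quotient.quot hboundaries).

Lemma hreprK u : hclass (hrepr u) = u. Proof. exact: reprK. Qed.

Lemma hclass_is_zmod : zmod_morphism hclass.
Proof. by move=> x y; rewrite /hclass raddfB. Qed.
HB.instance Definition _ := GRing.isZmodMorphism.Build hcycle homology hclass
  hclass_is_zmod.

Definition hscale (a : A) (u : homology) : homology := hclass (a *: hrepr u).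

Lemma hscaleE a z : hscale a (hclass z) = hclass (a *: z).
Proof.
apply/hclassP; have /hclassP[c e] := hreprK (hclass z).
by exists (a *: c); rewrite [RHS]linearZ_LR -e scalerBr.
Qed.

Fact hscaleA a b u : hscale a (hscale b u) = hscale (a * b) u.
Proof. by rewrite -(hreprK u) !hscaleE scalerA. Qed.
Fact hscale1 : left_id 1 hscale.
Proof. by move=> u; rewrite -(hreprK u) hscaleE scale1r. Qed.
Fact hscaleDr : right_distributive hscale +%R.
Proof.
move=> a u v; rewrite -(hreprK u) -(hreprK v) -raddfD !hscaleE scalerDr.
exact: raddfD.
Qed.
Fact hscaleDl u : {morph hscale^~ u : a b / a + b}.
Proof.
by move=> a b; rewrite -(hreprK u) !hscaleE scalerDl; exact: raddfD.
Qed.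
HB.instance Definition _ := GRing.Zmodule_isLmodule.Build A homology
  hscaleA hscale1 hscaleDr hscaleDl.

Lemma hclass_is_scalable : scalable hclass.
Proof. by move=> a z; rewrite -hscaleE. Qed.
HB.instance Definition _ := GRing.isScalable.Build A hcycle homology *:%R hclass
  hclass_is_scalable.

End Homology.

Section HomologyMap.
Variables (A : pzRingType) (C2 C1 C0 D2 D1 D0 : lmodType A).
Variables (d2 : {linear C2 -> C1}) (d1 : {linear C1 -> C0}).
Variables (e2 : {linear D2 -> D1}) (e1 : {linear D1 -> D0}).
Variables (f2 : {linear C2 -> D2}) (f1 : {linear C1 -> D1}).
Variables (f0 : {linear C0 -> D0}).
Hypotheses (f21 : forall c, f1 (d2 c) = e2 (f2 c)).
Hypotheses (f10 : forall c, f0 (d1 c) = e1 (f1 c)).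

Fact hcycle_map_subproof (z : hcycle d1) : f1 (hcycle_val z) \in hcycles e1.
Proof.
case: z => z /=; rewrite !unfold_in => /eqP z0.
by rewrite -f10 z0 linear0.
Qed.

Definition hcycle_map (z : hcycle d1) : hcycle e1 :=
  Hcycle (hcycle_map_subproof z).

#[using="f21"]
Definition homology_map (u : homology d2 d1) : homology e2 e1 :=
  hclass e2 (hcycle_map (hrepr u)).

Lemma homology_mapE z : homology_map (hclass d2 z) = hclass e2 (hcycle_map z).
Proof.
apply/hclassP; have /hclassP[c e] := hreprK (hclass d2 z).
by exists (f2 c); rewrite -linearB e f21.
Qed.

Fact homology_map_is_linear : linear homology_map.
Proof.
move=> a u v; rewrite -(hreprK u) -(hreprK v) -linearP !homology_mapE -linearP.
congr (hclass _ _); apply: val_inj => /=.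
by rewrite !linearP.
Qed.
HB.instance Definition _ := GRing.isLinear.Build A (homology d2 d1)
  (homology e2 e1) *:%R homology_map homology_map_is_linear.

End HomologyMap.

Section StandardSimplex.
Variable R : realType.

Definition stdsimplex (q : nat) : set 'rV[R]_q.+1 :=
  [set x | (forall j, 0 <= x ord0 j) /\ \sum_j x ord0 j = 1].

Arguments stdsimplex : clear implicits.

Definition insert0 (q : nat) (i : 'I_q.+2) (x : 'rV[R]_q.+1) : 'rV[R]_q.+2 :=
  \row_j oapp (x ord0) 0 (unlift i j).

Lemma insert0_lift q (i : 'I_q.+2) x j : insert0 i x ord0 (lift i j) = x ord0 j.
Proof. by rewrite mxE liftK. Qed.

Lemma insert0_id q (i : 'I_q.+2) x : insert0 i x ord0 i = 0.
Proof. by rewrite mxE unlift_none. Qed.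

Lemma insert0_continuous q (i : 'I_q.+2) : continuous (@insert0 q i).
Proof.
move=> x U [P nP PU]; exists (fun _ j => P ord0 (lift i j)).
  move=> k j; rewrite ord1; have := nP ord0 (lift i j).
  by rewrite insert0_lift.
move=> y Py; apply: PU => k j; rewrite ord1.
case: (unliftP i j) => [l|] ->; first by rewrite insert0_lift; exact: Py.
by rewrite insert0_id; apply: nbhs_singleton; rewrite -(insert0_id i x).
Qed.

Lemma insert0_simplex q (i : 'I_q.+2) (x : 'rV[R]_q.+1) :
  stdsimplex q x -> stdsimplex q.+1 (insert0 i x).
Proof.
move=> [x0 x1]; split=> [j|].
  by case: (unliftP i j) => [l|] ->; rewrite ?insert0_lift ?insert0_id.
rewrite (bigD1_ord i) //= insert0_id add0r -[RHS]x1.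
by apply: eq_bigr => j _; rewrite insert0_lift.
Qed.

Definition coface q (i : 'I_q.+2) (x : stdsimplex q) : stdsimplex q.+1 :=
  SigSub (mem_set (insert0_simplex i (set_valP x))).

Lemma coface_continuous q (i : 'I_q.+2) : continuous (coface i).
Proof.
apply: continuous_comp_initial => x.
apply: (@continuous_comp _ _ _ (set_val : stdsimplex q -> _) (insert0 i)).
  exact: initial_continuous.
exact: insert0_continuous.
Qed.

HB.instance Definition _ q (i : 'I_q.+2) :=
  isContinuous.Build _ _ (coface i) (@coface_continuous q i).

End StandardSimplex.
Arguments stdsimplex : clear implicits.

Section FreeModule.
Variables (A : nzRingType) (K : choiceType) (M : lmodType A).

Fact fglift_is_linear (f : K -> M) : linear (fglift f).
Proof.
have fB : zmod_morphism (fglift f) := lift_is_additive f.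
have f0 : fglift f 0 = 0 by rewrite -(subrr 0) fB subrr.
have fN x : fglift f (- x) = - fglift f x by rewrite -sub0r fB f0 sub0r.
have fD x y : fglift f (x + y) = fglift f x + fglift f y.
  by rewrite -[y in LHS]opprK fB fN opprK.
have fsum (I : Type) (r : seq I) (F : I -> {freeg K / A}) :
    fglift f (\sum_(i <- r) F i) = \sum_(i <- r) fglift f (F i).
  exact: (big_morph _ fD f0).
move=> a x y; rewrite fD; congr (_ + _).
rewrite -[in RHS](freeg_sumE x) [a *: x]/(fgscale a x) /fgscale !fsum scaler_sumr.
by apply: eq_bigr => z _; rewrite !liftU scalerA.
Qed.
HB.instance Definition _ (f : K -> M) :=
  GRing.isLinear.Build A {freeg K / A} M *:%R (fglift f) (fglift_is_linear f).

Lemma fglift1 (f : K -> M) z : fglift f << z >> = f z.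
Proof. by rewrite liftU scale1r. Qed.

Lemma freegUZ (c : A) (z : K) : << c *g z >> = c *: << z >> :> {freeg K / A}.
Proof. by apply/eqP/freeg_eqP => x; rewrite coeffZ !coeffU mul1r. Qed.

Lemma freeg_linear_ext (g h : {linear {freeg K / A} -> M}) :
  (forall z, g << z >> = h << z >>) -> g =1 h.
Proof.
move=> gh c; rewrite -(freeg_sumE c) !linear_sum.
by apply: eq_bigr => z _; rewrite freegUZ !linearZ_LR gh.
Qed.

End FreeModule.

Section SingularHomology.
Variables (R : realType) (A : nzRingType).
Implicit Types X Y Z : topologicalType.

Definition simplex X q : Type := continuousType (stdsimplex R q) X.
HB.instance Definition _ X q := Choice.on (simplex X q).

Definition chain X q : Type := {freeg (simplex X q) / A}.
HB.instance Definition _ X q := GRing.Lmodule.on (chain X q).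

Definition face X q (i : 'I_q.+2) (s : simplex X q.+1) : simplex X q :=
  s \o coface i.

Definition simplex_boundary X q : simplex X q -> chain X q.-1 :=
  match q with
  | 0 => fun _ => 0
  | q'.+1 => fun s => \sum_(i < q'.+2) (-1) ^+ i *: << face i s >>
  end.

(* In degree 0 this is the zero map [C_0 -> C_0], which has the same kernel as
   [C_0 -> 0]. *)
Definition boundary X q : {linear chain X q -> chain X q.-1} :=
  fglift (@simplex_boundary X q).

Definition singular_homology X q : lmodType A :=
  homology (boundary X q.+1) (boundary X q).

Definition simplex_map X Y (f : continuousType X Y) q (s : simplex X q) :
  simplex Y q := f \o s.

Definition chain_map X Y (f : continuousType X Y) q :
  {linear chain X q -> chain Y q} := fglift (fun s => << simplex_map f s >>).

Lemma boundaryU X q (s : simplex X q) :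
  boundary X q << s >> = simplex_boundary s.
Proof. exact: fglift1. Qed.

Lemma chain_mapU X Y (f : continuousType X Y) q (s : simplex X q) :
  chain_map f q << s >> = << simplex_map f s >>.
Proof. exact: (fglift1 (M := chain Y q)). Qed.

Lemma chain_map_boundary X Y (f : continuousType X Y) q (c : chain X q) :
  chain_map f q.-1 (boundary X q c) = boundary Y q (chain_map f q c).
Proof.
apply: (@freeg_linear_ext _ _ _ (chain_map f q.-1 \o boundary X q)
  (boundary Y q \o chain_map f q)) => s /=.
rewrite chain_mapU !boundaryU; case: q s {c} => [|q] s /=; first by rewrite linear0.
rewrite linear_sum; apply: eq_bigr => i _.
rewrite linearZ_LR chain_mapU; congr (_ *: << _ >>).
exact/continuousEP.
Qed.

Definition singular_homology_map X Y (f : continuousType X Y) q :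
    {linear singular_homology X q -> singular_homology Y q} :=
  homology_map (@chain_map_boundary X Y f q.+1) (@chain_map_boundary X Y f q).

Lemma singular_homology_mapE X Y (f : continuousType X Y) q
    (z : hcycle (boundary X q)) :
  singular_homology_map f q (hclass (boundary X q.+1) z) =
  hclass (boundary Y q.+1) (hcycle_map (@chain_map_boundary X Y f q) z).
Proof. exact: homology_mapE. Qed.

Lemma singular_homology_map_id X (f : continuousType X X) q u :
  f =1 id -> singular_homology_map f q u = u.
Proof.
move=> f1; rewrite -(hreprK u) singular_homology_mapE; congr hclass; apply: val_inj => /=.
apply: (freeg_linear_ext (g := chain_map f q) (h := idfun)) => s /=.
by rewrite chain_mapU; congr << _ >>; apply/continuousEP => x /=; rewrite f1.
Qed.

Lemma singular_homology_map_comp X Y Z (f : continuousType X Y)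
    (g : continuousType Y Z) (h : continuousType X Z) q u :
  h =1 g \o f ->
  singular_homology_map h q u =
  singular_homology_map g q (singular_homology_map f q u).
Proof.
move=> hE; rewrite -(hreprK u) !singular_homology_mapE; congr hclass.
apply: val_inj => /=.
apply: (freeg_linear_ext (g := chain_map h q)
  (h := chain_map g q \o chain_map f q)) => s /=.
by rewrite !chain_mapU; congr << _ >>; apply/continuousEP => x /=; rewrite hE.
Qed.

End SingularHomology.

(* [H_0(X; A)] is generated by the image of [H_0(X; Z)], so it is finitely
   generated as soon as [H_0(X; Z)] is. *)
Section BaseChange.
Variables (A : nzRingType) (K : choiceType).

Definition fgbase (c : {freeg K / int}) : {freeg K / A} :=
  \sum_(z <- dom c) << (coeff z c)%:~R *g z >>.

Lemma coeff_fgbase c x : coeff x (fgbase c) = (coeff x c)%:~R.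
Proof.
rewrite /fgbase raddf_sum /= -[in RHS](freeg_sumE c) raddf_sum rmorph_sum /=.
by apply: eq_bigr => z _; rewrite !coeffU rmorphM /= rmorph_nat.
Qed.

Lemma fgbase1 z : fgbase << z >> = << z >>.
Proof.
by apply/eqP/freeg_eqP => x; rewrite coeff_fgbase !coeffU !mul1r rmorph_nat.
Qed.

Lemma fgbaseD : {morph fgbase : c e / c + e}.
Proof.
by move=> c e; apply/eqP/freeg_eqP => x; rewrite coeffD !coeff_fgbase coeffD rmorphD.
Qed.

Lemma fgbaseZ a c : fgbase (a *: c) = a%:~R *: fgbase c.
Proof.
by apply/eqP/freeg_eqP => x; rewrite coeffZ !coeff_fgbase coeffZ rmorphM.
Qed.

Lemma fgbase0 : fgbase 0 = 0.
Proof. by rewrite -(scale0r 0) fgbaseZ scale0r. Qed.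

Lemma fgbase_sum (I : Type) (r : seq I) (F : I -> {freeg K / int}) :
  fgbase (\sum_(i <- r) F i) = \sum_(i <- r) fgbase (F i).
Proof. exact: (big_morph _ fgbaseD fgbase0). Qed.

End BaseChange.

Section DegreeZero.
Variables (R : realType) (X : topologicalType).

Lemma boundary_base (A : nzRingType) q (c : chain R int X q) :
  fgbase A (boundary R int X q c) = boundary R A X q (fgbase A c).
Proof.
rewrite -(freeg_sumE c) linear_sum !fgbase_sum linear_sum.
apply: eq_bigr => s _; rewrite freegUZ linearZ_LR !fgbaseZ linearZ_LR.
rewrite fgbase1 !boundaryU; congr (_ *: _).
case: q s {c} => [|q] s /=; first exact: fgbase0.
rewrite fgbase_sum; apply: eq_bigr => i _.
by rewrite fgbaseZ fgbase1 rmorphXn rmorphN1.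
Qed.

Lemma cycle0 (A : nzRingType) (c : chain R A X 0) : c \in hcycles (boundary R A X 0).
Proof.
rewrite unfold_in -(freeg_sumE c) linear_sum big1 // => s _.
by rewrite freegUZ linearZ_LR boundaryU scaler0.
Qed.

Definition class0 (A : nzRingType) (c : chain R A X 0) :
  singular_homology R A X 0 := hclass _ (Hcycle (cycle0 c)).

Lemma class0P (A : nzRingType) (c e : chain R A X 0) :
  class0 c = class0 e <-> exists b, c - e = boundary R A X 1 b.
Proof. exact: hclassP. Qed.

Lemma class0_is_linear (A : nzRingType) : linear (@class0 A).
Proof.
by move=> a c e; rewrite /class0 -linearP; congr hclass; apply: val_inj.
Qed.
HB.instance Definition _ (A : nzRingType) := GRing.isLinear.Build A (chain R A X 0)
  (singular_homology R A X 0) *:%R (@class0 A) (@class0_is_linear A).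

Lemma class0_repr (A : nzRingType) (u : singular_homology R A X 0) :
  class0 (hcycle_val (hrepr u)) = u.
Proof. by rewrite -[RHS]hreprK; congr hclass; apply: val_inj. Qed.

Lemma fin_gen_homology0 (A : nzRingType) :
  fin_gen (singular_homology R int X 0) -> fin_gen (singular_homology R A X 0).
Proof.
move=> [m [g gP]]; pose r l := hcycle_val (hrepr (g l)).
exists m, (fun l => class0 (fgbase A (r l))) => v.
have gens (s : simplex R X 0) : exists a : 'I_m -> A,
    class0 << s >> = \sum_(l < m) a l *: class0 (fgbase A (r l)).
  have [a aP] := gP (class0 << s >>).
  have {aP} : class0 << s >> = class0 (\sum_(l < m) a l *: r l).
    rewrite aP linear_sum; apply: eq_bigr => l _.
    rewrite [RHS]linearZ_LR; congr (_ *: _); exact/esym/class0_repr.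
  move=> /class0P[b /(congr1 (fun c => c + \sum_(l < m) a l *: r l))].
  rewrite subrK => /(congr1 (@fgbase A _)); rewrite fgbase1 fgbaseD boundary_base => e.
  exists (fun l => (a l)%:~R); transitivity (class0 (fgbase A (\sum_(l < m) a l *: r l))).
    by apply/class0P; exists (fgbase A b); rewrite e addrK.
  by rewrite fgbase_sum linear_sum; apply: eq_bigr => l _; rewrite fgbaseZ linearZ_LR.
have [a aP] := choice gens.
pose c := hcycle_val (hrepr v).
exists (fun l => \sum_(s <- dom c) coeff s c * a s l).
rewrite -[LHS]class0_repr -/c -[in LHS](freeg_sumE c) linear_sum.
under [RHS]eq_bigr do rewrite scaler_suml.
rewrite exchange_big; apply: eq_bigr => s _.
rewrite freegUZ; transitivity (coeff s c *: class0 << s >>).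
  exact: linearZ_LR.
rewrite aP scaler_sumr; apply: eq_bigr => l _.
by rewrite scalerA.
Qed.

End DegreeZero.

(* Vertices are numbered from 0. *)
Record zigzag (n : nat) := Zigzag {
  zedge :> rel 'I_n;
  zedge_adj : forall i j, zedge i j -> (j == i.+1 :> nat) || (i == j.+1 :> nat);
  zedge_or : forall i j : 'I_n, j = i.+1 :> nat -> zedge i j (+) zedge j i
}.

(* There is a morphism [i -> j] in the path category of [T] if and only if
   [connect T i j]; it is unique since [connect T i j] is a boolean. *)

Record top_diagram (R : realType) (n : nat) (T : zigzag n) := TopDiagram {
  dspace :> 'I_n -> topologicalType;
  dspace_fin_gen : forall i q, fin_gen (singular_homology R int (dspace i) q);
  dmap : forall i j, connect T i j -> continuousType (dspace i) (dspace j);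
  dmap_id : forall i (h : connect T i i) x, dmap h x = x;
  dmap_comp : forall i j k (hij : connect T i j) (hjk : connect T j k)
    (hik : connect T i k) x, dmap hik x = dmap hjk (dmap hij x)
}.

Record zzmodule (k : fieldType) (n : nat) (T : zigzag n) := ZZModule {
  zspace :> 'I_n -> lmodType k;
  zspace_fin_dim : forall i, fin_gen (zspace i);
  zmap : forall i j, connect T i j -> {linear zspace i -> zspace j};
  zmap_id : forall i (h : connect T i i) v, zmap h v = v;
  zmap_comp : forall i j l (hij : connect T i j) (hjl : connect T j l)
    (hil : connect T i l) v, zmap hil v = zmap hjl (zmap hij v)
}.

Definition zziso (k : fieldType) n (T : zigzag n) (V W : zzmodule k T) : Prop :=
  exists f : forall i, {linear V i -> W i},
    (forall i, bijective (f i)) /\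
    (forall i j (h : connect T i j) v, f j (zmap V h v) = zmap W h (f i v)).

Definition H0 (R : realType) n (T : zigzag n) (X : top_diagram R T)
    (k : fieldType) : zzmodule k T :=
  ZZModule
    (fun i => fin_gen_homology0 k (dspace_fin_gen X i 0))
    (zmap := fun i j h => singular_homology_map R k (dmap X h) 0)
    (fun i h u => singular_homology_map_id u (dmap_id h))
    (fun i j l hij hjl hil u =>
       singular_homology_map_comp u (dmap_comp hij hjl hil)).

Section Paths.
Variables (n : nat) (T : zigzag n).

Lemma zedge_asym i j : T i j -> ~~ T j i.
Proof.
move=> Tij; have /orP[/eqP e | /eqP e] := zedge_adj Tij;
  have := zedge_or T e; rewrite Tij //.
by rewrite addbT.
Qed.

Lemma connect_edge i j (a b : 'I_n) : connect T i j -> b = a.+1 :> nat ->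
  ((i <= a -> b <= j -> T a b) /\ (j <= a -> b <= i -> T b a))%N.
Proof.
move=> /connectP[p]; elim: p i => [|x p IH] i /= pT jE ab.
  by rewrite jE; split; lia.
case/andP: pT => Tix pT; have [IH1 IH2] := IH x pT jE ab.
have /orP[/eqP xi | /eqP ix] := zedge_adj Tix; split=> h1 h2.
- have [le|lt] := leqP x a; first exact: IH1.
  have -> : a = i by apply: val_inj => /=; lia.
  by have -> : b = x by apply: val_inj => /=; lia.
- by apply: IH2 => //; lia.
- by apply: IH1 => //; lia.
- have [le|lt] := leqP b x; first exact: IH2.
  have -> : a = x by apply: val_inj => /=; lia.
  by have -> : b = i by apply: val_inj => /=; lia.
Qed.

Lemma connect_monotone i j l : connect T i j -> connect T j l ->
  ((i <= j <= l) || (l <= j <= i))%N.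
Proof.
move=> hij hjl; apply/negP => /negP.
rewrite negb_or !negb_and -!ltnNge => /andP[h1 h2].
have [[ij lj]|[ji jl]] : (i < j /\ l < j)%N \/ (j < i /\ j < l)%N by lia.
  have j0 : (j.-1 < n)%N by have := ltn_ord j; lia.
  have e : j = (Ordinal j0).+1 :> nat by move=> /=; lia.
  have [/(_ _ (leqnn _)) Tj _] := connect_edge hij e.
  have [_ /(_ _ (leqnn _)) jT] := connect_edge hjl e.
  have /negP := zedge_asym (Tj ltac:(rewrite /=; lia)).
  by apply; apply: jT; rewrite /=; lia.
have j1 : (j.+1 < n)%N by have := ltn_ord l; lia.
have e : Ordinal j1 = j.+1 :> nat by [].
have [_ /(_ (leqnn _) ji) Tj] := connect_edge hij e.
have [/(_ (leqnn _) jl) jT _] := connect_edge hjl e.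
by have /negP := zedge_asym Tj.
Qed.

End Paths.

Section IntervalModule.
Variables (k : fieldType) (n : nat) (T : zigzag n) (p : 'I_n * 'I_n).

Definition in_interval (i : 'I_n) : bool := (p.1 <= i <= p.2)%N.

(* The space at [i] is [k^1] or [k^0]. *)
Definition ispace (i : 'I_n) : lmodType k := 'rV[k]_(in_interval i).

(* [pid_mx 1] is the identity matrix if [i] and [j] are both in the interval,
   and the unique matrix of its size otherwise. *)
Definition imap (i j : 'I_n) (h : connect T i j) : {linear ispace i -> ispace j} :=
  mulmxr (pid_mx 1).

Fact imap_id i (h : connect T i i) v : imap h v = v.
Proof.
rewrite /imap /= /ispace in v *; case: (in_interval i) v => v.
  by rewrite pid_mx_1 mulmx1.
by rewrite [LHS]thinmx0 [RHS]thinmx0.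
Qed.

Fact imap_comp i j l (hij : connect T i j) (hjl : connect T j l)
  (hil : connect T i l) v : imap hil v = imap hjl (imap hij v).
Proof.
rewrite /= -mulmxA; congr (_ *m _).
have : in_interval i -> in_interval l -> in_interval j.
  by have := connect_monotone hij hjl; rewrite /in_interval; lia.
case: (in_interval i) => [|_]; last by apply/matrixP => -[].
case: (in_interval l) => [|_]; last by apply/matrixP => ? [].
by move=> /(_ isT isT) ->; rewrite mul_pid_mx.
Qed.

Fact ispace_fin_dim i : fin_gen (ispace i).
Proof.
exists (in_interval i), (fun l => delta_mx 0 l) => v; exists (v 0).
exact: row_sum_delta.
Qed.

Definition interval_module : zzmodule k T :=
  ZZModule ispace_fin_dim imap_id imap_comp.

End IntervalModule.

Definition dsum (k : pzRingType) (J : finType) (V : J -> lmodType k) : Type :=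
  forall j, V j.

Section DirectSum.
Variables (k : pzRingType) (J : finType) (V : J -> lmodType k).
Local Notation W := (dsum V).
Implicit Types u v w : W.

HB.instance Definition _ := Choice.on W.

Let add u v : W := fun j => u j + v j.
Let opp u : W := fun j => - u j.
Let zero : W := fun j => 0.
Let scale a u : W := fun j => a *: u j.

Let addA : associative add.
Proof. by move=> u v w; apply/functional_extensionality_dep => j; exact: addrA. Qed.
Let addC : commutative add.
Proof. by move=> u v; apply/functional_extensionality_dep => j; exact: addrC. Qed.
Let add0 : left_id zero add.
Proof. by move=> u; apply/functional_extensionality_dep => j; exact: add0r. Qed.
Let addN : left_inverse zero opp add.
Proof. by move=> u; apply/functional_extensionality_dep => j; exact: addNr. Qed.
HB.instance Definition _ := GRing.isZmodule.Build W addA addC add0 addN.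

Let scaleA a b u : scale a (scale b u) = scale (a * b) u.
Proof. by apply/functional_extensionality_dep => j; exact: scalerA. Qed.
Let scale1 : left_id 1 scale.
Proof. by move=> u; apply/functional_extensionality_dep => j; exact: scale1r. Qed.
Let scaleDr : right_distributive scale +%R.
Proof. by move=> a u v; apply/functional_extensionality_dep => j; exact: scalerDr. Qed.
Let scaleDl u : {morph scale^~ u : a b / a + b}.
Proof. by move=> a b; apply/functional_extensionality_dep => j; exact: scalerDl. Qed.
HB.instance Definition _ := GRing.Zmodule_isLmodule.Build k W
  scaleA scale1 scaleDr scaleDl.

Lemma dsum_sumE (I : Type) (r : seq I) (F : I -> W) j :
  (\sum_(i <- r) F i) j = \sum_(i <- r) F i j.
Proof. by elim/big_rec2: _ => // i ? ? _ <-. Qed.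

Definition dsum_in j (x : V j) : W := fun j' =>
  if eqP is ReflectT e then ecast i (V i) e x else 0 : V j'.

Lemma dsum_in_sum u : u = \sum_j dsum_in (u j).
Proof.
apply/functional_extensionality_dep => j; rewrite dsum_sumE (bigD1 j) //=.
rewrite /dsum_in big1 => [|i /eqP ij]; last by case: eqP.
by case: eqP => // e; rewrite (eq_axiomK e) addr0.
Qed.

Lemma dsum_in_linear j : linear (@dsum_in j).
Proof.
move=> a x y; apply/functional_extensionality_dep => i.
rewrite /dsum_in [RHS]/GRing.add /= /add [in RHS]/GRing.scale /= /scale.
by case: eqP => [e|_]; [case: _ / e | rewrite scaler0 addr0].
Qed.
HB.instance Definition _ j := GRing.isLinear.Build k (V j) W *:%R (@dsum_in j)
  (@dsum_in_linear j).

Lemma dsum_fin_gen : (forall j, fin_gen (V j)) -> fin_gen W.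
Proof.
move=> fgV; pose m j := sval (cid (fgV j)).
pose g j : 'I_(m j) -> V j := sval (cid (svalP (cid (fgV j)))).
have gP j : forall v : V j, exists a : 'I_(m j) -> k, v = \sum_(l < m j) a l *: g j l.
  exact: svalP (cid (svalP (cid (fgV j)))).
apply: (@fin_gen_finType _ _ {j : J & 'I_(m j)}
  (fun q => dsum_in (g (tag q) (tagged q)))) => u.
pose a j := sval (cid (gP j (u j))).
have aP j : u j = \sum_(l < m j) a j l *: g j l := svalP (cid (gP j (u j))).
exists (fun q => a (tag q) (tagged q)).
transitivity (\sum_j \sum_(l < m j) a j l *: dsum_in (g j l)); last first.
  by rewrite sig_big_dep.
rewrite [LHS]dsum_in_sum; apply: eq_bigr => j _.
rewrite {1}aP linear_sum; apply: eq_bigr => l _.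
exact: linearZ_LR.
Qed.

End DirectSum.

Section DirectSumMap.
Variables (k : pzRingType) (J : finType) (V W : J -> lmodType k).
Variable f : forall j, {linear V j -> W j}.

Definition dsum_map (u : dsum V) : dsum W := fun j => f j (u j).

Fact dsum_map_is_linear : linear dsum_map.
Proof.
by move=> a u v; apply/functional_extensionality_dep => j; exact: linearP.
Qed.
HB.instance Definition _ := GRing.isLinear.Build k (dsum V) (dsum W) *:%R dsum_map
  dsum_map_is_linear.

End DirectSumMap.

Section ZZDirectSum.
Variables (k : fieldType) (n : nat) (T : zigzag n) (J : finType).
Variable V : J -> zzmodule k T.

Definition zzsum_space (i : 'I_n) : lmodType k := dsum (fun j => V j i).

Definition zzsum_map i j (h : connect T i j) :
    {linear zzsum_space i -> zzsum_space j} :=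
  dsum_map (fun l => zmap (V l) h).

Fact zzsum_id i (h : connect T i i) u : zzsum_map h u = u.
Proof. by apply/functional_extensionality_dep => j; exact: zmap_id. Qed.

Fact zzsum_comp i j l (hij : connect T i j) (hjl : connect T j l)
  (hil : connect T i l) u : zzsum_map hil u = zzsum_map hjl (zzsum_map hij u).
Proof. by apply/functional_extensionality_dep => a; exact: zmap_comp. Qed.

Definition zzsum : zzmodule k T :=
  ZZModule (fun i => dsum_fin_gen (fun j => zspace_fin_dim (V j) i))
    zzsum_id zzsum_comp.

End ZZDirectSum.

Section Barcode.
Variables (k : fieldType) (n : nat) (T : zigzag n) (V : zzmodule k T).

Definition interval_decomposition (s : seq ('I_n * 'I_n)) : Prop :=
  all (fun p : 'I_n * 'I_n => (p.1 <= p.2)%N) s /\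
  zziso V (zzsum (fun j : 'I_(size s) => interval_module k T (tnth (in_tuple s) j))).

(* By the decomposition theorem for zigzag modules an interval decomposition of
   [V] exists and is unique up to permutation, so that the multiset does not
   depend on the one chosen here and the default value [[::]] is not used. *)
Definition Bar : {mset 'I_n * 'I_n}%mset :=
  seq_mset (xget [::] interval_decomposition).

End Barcode.

(* Main.v *)
From HB Require Import structures.
Require Import Defs.
From mathcomp Require Import freeg.
From mathcomp Require Import all_boot all_order all_algebra.
From mathcomp Require Import finmap multiset zify.
From mathcomp Require Import all_classical reals topology.

(** The barcode of a zigzag module [V] is recovered from its generalized ranks.
For an interval [p = (b, d)] call section a choice of vectors [v i] in [V i],
[b <= i <= d], compatible with the maps of [V], and cosection a choice of linear
forms [phi i] compatible with these maps. The value [phi i (v i)] does not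
depend on [i], so that sections and cosections are paired; the rank of this
pairing is the rank of the canonical map from the limit to the colimit of [V]
over [p]. It is additive, and for an interval module it is 1 if the interval
contains [p] and 0 otherwise: a section or cosection of an interval that does not
contain [p] vanishes at an end of [p]. So the generalized rank over [p] counts
the bars that contain [p] ([rank_ge_zzsum], [rank_ge_zzsum_le]), and these counts
determine the multiset of bars ([perm_eq_of_covers]).

For [H_0] the generalized rank has a meaning that does not involve the field. The
points of the spaces [X i], [b <= i <= d], fall into classes under the
equivalence generated by the paths in each [X i] and by the maps of the diagram;
these are the components of a mapping telescope. The rank over [p] is the number
of components that meet both [X b] and [X d]. Indeed, a cosection is constant on
components, and a section has on each component a total coefficient that is the
same at all levels, hence is 0 if the component misses an end; so the pairing
factors through the spanning components ([spanning_of_rank_ge]). Conversely, a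
chain of links from a point of [X b] to a point of [X d] carries a unit flow,
whose value at each level is a section, and the indicators of the components
separate these sections ([rank_ge_of_spanning]).

The remaining ingredient is that every zigzag module has an interval
decomposition ([interval_decomposition_exists]). It is proved by adding one level
at a time to a basis made of intervals. The new arrow singles out a subspace of
the last space, its kernel or its image according to the direction, and the
basis of the last space has to be adapted to this subspace. A basis vector can
only be modified by vectors that do not break the compatibility further to the
left; the intervals that reach the last level are totally ordered in this
respect, which makes a triangular change of basis sufficient
([interval_basis_adapt]). *)

Set Implicit Arguments.
Unset Strict Implicit.
Unset Printing Implicit Defensive.

Import Order.TTheory GRing.Theory Num.Theory.

Local Open Scope ring_scope.

(** * Bases of modules over a field *)

Section Bases.
Variables (k : fieldType) (W : lmodType k).

(** Families come with a predicate because a single index set of intervals serves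
all levels, and only the intervals alive at a level provide vectors there. *)
Definition free_on (J : finType) (P : pred J) (e : J -> W) : Prop :=
  forall a : J -> k, \sum_(j | P j) a j *: e j = 0 -> forall j, P j -> a j = 0.

Definition spans_on (J : finType) (P : pred J) (e : J -> W) : Prop :=
  forall v, exists a : J -> k, v = \sum_(j | P j) a j *: e j.

Definition basis_on (J : finType) (P : pred J) (e : J -> W) : Prop :=
  free_on P e /\ spans_on P e.

Lemma eq_basis_on (J : finType) (P Q : pred J) (e f : J -> W) :
  P =1 Q -> (forall j, P j -> e j = f j) -> basis_on P e -> basis_on Q f.
Proof.
move=> PQ ef [fr sp].
have E (a : J -> k) : \sum_(j | Q j) a j *: f j = \sum_(j | P j) a j *: e j.
  by apply: eq_big => [j|j]; rewrite -PQ // => Pj; rewrite ef.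
split=> [a|v]; first by rewrite E => /fr a0 j; rewrite -PQ; exact: a0.
by have [a ->] := sp v; exists a; rewrite E.
Qed.

Lemma free_on_eq (J : finType) (P : pred J) (e : J -> W) (a c : J -> k) :
  free_on P e -> \sum_(j | P j) a j *: e j = \sum_(j | P j) c j *: e j ->
  forall j, P j -> a j = c j.
Proof.
move=> fr E j Pj; apply/eqP; rewrite -subr_eq0; apply/eqP.
apply: (fr (fun j => a j - c j)) => //.
under eq_bigr do rewrite scalerBl.
by rewrite sumrB E subrr.
Qed.

(** A transvection is invertible: the coefficients with respect to the old and
    to the new family differ by a multiple of those of [w]. *)
Lemma basis_on_transvection (J : finType) (P : pred J) (e e' : J -> W) t
    (c : J -> k) :
  P t -> c t = 0 -> (forall j, j != t -> e' j = e j) ->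
  e' t = e t + \sum_(j | P j) c j *: e j ->
  basis_on P e -> basis_on P e'.
Proof.
move=> Pt ct e'j e't [fr sp].
have E (a : J -> k) :
    \sum_(j | P j) a j *: e' j = \sum_(j | P j) (a j + a t * c j) *: e j.
  under [RHS]eq_bigr do rewrite scalerDl -scalerA.
  rewrite big_split -scaler_sumr /= (bigD1 t) //= e't scalerDr.
  rewrite [\sum_(j | P j) a j *: e j](bigD1 t) //= -!addrA; congr (_ + _).
  rewrite addrC; congr (_ + _).
  by apply: eq_bigr => j /andP[_ jt]; rewrite e'j.
split=> [a|v].
  rewrite E => /fr a0; have at0 : a t = 0.
    by have := a0 t Pt; rewrite ct mulr0 addr0.
  by move=> j Pj; have := a0 j Pj; rewrite at0 mul0r addr0.
have [a ->] := sp v; exists (fun j => a j - a t * c j).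
by rewrite E; apply: eq_bigr => j _; rewrite ct mulr0 subr0 subrK.
Qed.

(** More than [M] vectors in a space with [M] generators have a coordinate matrix
with a nontrivial left kernel. *)
Lemma free_family_bound : fin_gen W ->
  exists M : nat, forall q (g : 'I_q -> W), free_on xpredT g -> (q <= M)%N.
Proof.
move=> [M [h hP]]; exists M => q g fr.
have [a aP] := choice (fun i => hP (g i)).
pose B := \matrix_(i < q, l < M) a i l.
suff /eqP <- : \rank B == q by exact: rank_leq_col.
rewrite -[_ == q]/(row_free B) -kermx_eq0; apply/eqP/row_matrixP => r.
apply/rowP => i; rewrite row0 [LHS]mxE [RHS]mxE.
apply: (fr (fun i => kermx B r i)) => //.
under eq_bigr do rewrite aP scaler_sumr.
rewrite exchange_big big1 // => l _.
under eq_bigr do rewrite scalerA.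
rewrite -scaler_suml.
have /matrixP /(_ r l) := mulmx_ker B; rewrite mxE [RHS]mxE.
by under eq_bigr do rewrite [B _ _]mxE; move=> ->; rewrite scale0r.
Qed.

(** A longest free extension by vectors of [G] spans. Drawing the new vectors from
a subset [G] is what allows intervals to be born in the kernel of a map. *)
Lemma extend_to_basis (J : finType) (P : pred J) (y : J -> W) (G : W -> Prop) :
  fin_gen W -> free_on P y ->
  (forall v, exists (a : J -> k) w, G w /\ v = \sum_(j | P j) a j *: y j + w) ->
  exists q (g : 'I_q -> W), (forall i, G (g i)) /\
    basis_on (fun x : J + 'I_q => if x is inl j then P j else true)
             (fun x => match x with inl j => y j | inr i => g i end).
Proof.
move=> fgW yfree yG.
pose PP q := fun x : J + 'I_q => if x is inl j then P j else true.
pose yg q (g : 'I_q -> W) := fun x : J + 'I_q =>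
  match x with inl j => y j | inr i => g i end.
pose ok q := `[< exists g : 'I_q -> W,
  (forall i, G (g i)) /\ free_on (@PP q) (yg q g) >].
have sumE q (g : 'I_q -> W) (a : J + 'I_q -> k) :
    \sum_(x | PP q x) a x *: yg q g x =
    \sum_(j | P j) a (inl j) *: y j + \sum_i a (inr i) *: g i.
  by rewrite big_sumType.
have [M Mbound] := free_family_bound fgW.
have ok0 : ok 0%N.
  apply/asboolP; exists (fun _ => 0); split=> [[]//|a].
  by rewrite sumE big_ord0 addr0 => /yfree a0 [j|[]//] Pj; exact: (a0 j).
have okM q : ok q -> (q <= M)%N.
  move=> /asboolP[g [_ fr]]; apply: (Mbound q g) => a a0 i _.
  pose c (x : J + 'I_q) := match x with inl _ => 0 | inr i => a i end.
  apply: (fr c _ (inr i)) => //.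
  by rewrite sumE a0 addr0 big1 // => j _; rewrite scale0r.
have [q /asboolP[g [gG fr]] qmax] := ex_maxnP (ex_intro ok 0%N ok0) okM.
exists q, g; split=> //; split=> //.
have Gsp w : G w -> exists a, w = \sum_(x | PP q x) a x *: yg q g x.
  move=> Gw; apply: contrapT => nsp.
  (* Otherwise [w] prolongs the longest extension. *)
  pose g' (i : 'I_q.+1) := oapp g w (unlift ord0 i).
  suff /qmax : ok q.+1 by rewrite ltnn.
  apply/asboolP; exists g'; split=> [i|a].
    by rewrite /g'; case: unliftP => //=.
  rewrite sumE big_ord_recl /g' unlift_none /=.
  under [X in _ + (_ + X)]eq_bigr do rewrite liftK /=.
  set S1 := \sum_(j | P j) _; set S2 := \sum_(i < q) _ => E.
  have aw : a (inr ord0) = 0.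
    apply: contrapT => /eqP a0; apply: nsp.
    exists (fun x => - (a (inr ord0))^-1 *
      match x with inl j => a (inl j) | inr i => a (inr (lift ord0 i)) end).
    under eq_bigr do rewrite -scalerA.
    rewrite -scaler_sumr sumE -/S1 -/S2.
    have -> : S1 + S2 = - (a (inr ord0) *: w).
      by apply/eqP; rewrite -addr_eq0 -addrA [S2 + _]addrC E.
    by rewrite scalerN scaleNr opprK scalerA mulVf ?scale1r.
  move: E; rewrite aw scale0r add0r => E.
  have {}fr := fr (fun x => match x with inl j => a (inl j)
    | inr i => a (inr (lift ord0 i)) end).
  rewrite sumE in fr; have {}fr := fr E.
  move=> [j|i] Pj; first exact: (fr (inl j)).
  case: (unliftP ord0 i) => [i'|] -> //; exact: (fr (inr i')).
move=> v; have [a [w [Gw ->]]] := yG v; have [c ->] := Gsp w Gw.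
exists (fun x => (if x is inl j then a j else 0) + c x).
under [RHS]eq_bigr do rewrite scalerDl.
rewrite big_split; congr (_ + _).
rewrite (sumE _ _ (fun x => if x is inl j then a j else 0)).
by rewrite [X in _ + X]big1 ?addr0 // => i _; rewrite scale0r.
Qed.

End Bases.

(** * Existence of interval decompositions *)

Lemma dsum_in_id (k : pzRingType) (J : finType) (V : J -> lmodType k) j
  (x : V j) : dsum_in x j = x.
Proof. by rewrite /dsum_in; case: eqP => // e; rewrite (eq_axiomK e). Qed.

Lemma dsum_in_neq (k : pzRingType) (J : finType) (V : J -> lmodType k) j i
  (x : V j) : j != i -> dsum_in x i = 0.
Proof. by rewrite /dsum_in; case: eqP. Qed.

Section Existence.
Variables (k : fieldType) (n : nat) (T : zigzag n) (V : zzmodule k T).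
Implicit Types (p : 'I_n * 'I_n) (x y : dsum (fun i => V i)).

Lemma dsumDE x y i : (x + y) i = x i + y i. Proof. by []. Qed.
Lemma dsumZE (a : k) x i : (a *: x) i = a *: x i. Proof. by []. Qed.

Lemma dsum_bigE (I : Type) (r : seq I) (P : pred I) (F : I -> dsum (fun i => V i)) i :
  (\sum_(j <- r | P j) F j) i = \sum_(j <- r | P j) F j i.
Proof. by elim/big_rec2: _ => // j ? ? _ <-. Qed.

(** A homomorphism from the interval module of [p] to the restriction of [V] to
the levels below [m], encoded by the images of the generators. Nothing is asked
of the arrows that enter the interval: their source is 0 in the interval module.
*)
Definition partial_family (m : nat) p x : Prop :=
  (forall i, ~~ in_interval p i -> x i = 0) /\
  (forall i j (h : T i j), (i < m)%N -> (j < m)%N -> in_interval p i ->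
    zmap V (connect1 h) (x i) = x j).

Lemma partial_family_lin m p (a : k) x y :
  partial_family m p x -> partial_family m p y -> partial_family m p (x + a *: y).
Proof.
move=> [x0 xh] [y0 yh]; split=> [i ip|i j h im jm ip].
  by rewrite dsumDE dsumZE x0 ?y0 // scaler0 addr0.
by rewrite !dsumDE !dsumZE linearD linearZ_LR xh ?yh.
Qed.

(** The arrow on the left of [b] points to [b]. *)
Definition forward (b : 'I_n) : bool :=
  [exists a : 'I_n, (b == a.+1 :> nat) && T a b].

(** The key orders the intervals that share their last level [d] by the existence
of nonzero homomorphisms: if [birth_key b' <= birth_key b], then a family on
[(b', d)] restricts or extends by 0 to a family on [(b, d)]. An arrow that
enters [b] imposes no condition at [b], so such a [b] accepts every family that
was born before, and comes after all of them; an arrow that leaves [b] makes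
families born at [b] vanish on the left of [b], so that they extend by 0, and
such a [b] comes before all smaller births. *)
Definition birth_key (b : 'I_n) : int := if forward b then b%:Z else - b%:Z.

Definition truncate p x : dsum (fun i => V i) :=
  fun i => if in_interval p i then x i else 0.

(** The two critical places are the left ends of the intervals. At the birth of
[p] an arrow that leaves forces the key of [p'] to be at most [- p.1], hence [p']
to be born there or later. Before the birth of [p'] an arrow that enters would
give [p'] a key larger than that of [p]. *)
Lemma partial_family_truncate (p p' : 'I_n * 'I_n) x :
  p.2 = p'.2 -> (birth_key p'.1 <= birth_key p.1)%R ->
  partial_family p.2.+1 p' x -> partial_family p.2.+1 p (truncate p x).
Proof.
move=> pp' key [x0 xh]; split=> [i /negbTE ip|i j h im jm ip].
  by rewrite /truncate ip.
rewrite {1}/truncate ip.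
have pi : (p.1 <= i)%N by case/andP: ip.
have xj : (j < p'.1)%N -> x j = 0.
  by move=> jp; apply: x0; rewrite /in_interval; lia.
have [ip'|ip'] := leqP p'.1 i.
  rewrite xh // /truncate; last by rewrite /in_interval -pp' ip'; case/andP: ip.
  case: ifP => // jp.
  have jb : p.1 = j.+1 :> nat.
    have := zedge_adj h; move: jp; rewrite /in_interval; lia.
  have ib : i = p.1.
    by apply: val_inj => /=; have := zedge_adj h; lia.
  have bwd : ~~ forward p.1.
    apply/existsP => -[a /andP[/eqP ab Tab]].
    have aj : a = j by apply: val_inj => /=; lia.
    by have := zedge_asym h; rewrite ib -aj Tab.
  apply: xj; move: key; rewrite /birth_key (negbTE bwd) jb.
  case: ifP => _; lia.
rewrite x0 ?linear0; last by rewrite /in_interval; lia.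
rewrite /truncate; case: ifP => // jp; apply/esym.
have [|jp'] := ltnP j p'.1; first exact: xj.
have jE : j = p'.1 by apply: val_inj => /=; have := zedge_adj h; lia.
have fw : forward p'.1.
  apply/existsP; exists i; rewrite -jE h andbT.
  have := zedge_adj h; lia.
move: key; rewrite /birth_key fw; case: ifP => _; lia.
Qed.

(** An interval decomposition of the restriction of [V] to the levels below [m]:
the families that are alive at a level form a basis of the space there. *)
Record interval_basis (m : nat) (J : finType) (p : J -> 'I_n * 'I_n)
    (e : J -> dsum (fun i => V i)) : Prop := IntervalBasis {
  ib_valid : forall j, ((p j).1 <= (p j).2 < m)%N;
  ib_family : forall j, partial_family m (p j) (e j);
  ib_basis : forall i : 'I_n, (i < m)%N ->
    basis_on (fun j => in_interval (p j) i) (fun j => e j i)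
}.

(** At every level the replaced vector changes by a combination of other vectors of
the basis, as vectors of [Q] that are not alive vanish there. *)
Lemma interval_basis_adapt_step m (J : finType) (p : J -> 'I_n * 'I_n) e t
    (Q : pred J) (c : J -> k) :
  (p t).2.+1 = m :> nat -> t \notin Q ->
  (forall j, j \in Q ->
    (p j).2 = (p t).2 /\ (birth_key (p j).1 <= birth_key (p t).1)%R) ->
  interval_basis m p e ->
  interval_basis m p (fun j => if j == t then
    e t + \sum_(j' in Q) c j' *: truncate (p t) (e j') else e j).
Proof.
move=> tm tQ Qt [vld fam bas]; split=> // [j|i im].
  case: eqP => [->|_]; last exact: fam.
  elim/big_rec: _ => [|j' x jQ IH]; first by rewrite addr0; exact: fam.
  rewrite addrCA addrC; apply: partial_family_lin => //.
  have [pE kE] := Qt _ jQ; rewrite -tm.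
  apply: (@partial_family_truncate _ (p j')) => //.
  by rewrite tm.
have [ti|ti] := boolP (in_interval (p t) i); last first.
  apply: eq_basis_on (bas i im) => // j ji; case: eqP => // jt.
  by rewrite jt (negbTE ti) in ji.
apply: (basis_on_transvection (e := fun j => e j i) (t := t)
  (c := fun j => if j \in Q then c j else 0)) => //.
- by rewrite (negbTE tQ).
- by move=> j /negbTE ->.
- rewrite eqxx dsumDE dsum_bigE; congr (_ + _).
  rewrite big_mkcond [RHS]big_mkcond /=; apply: eq_bigr => j _.
  case: ifP => jQ; last by case: ifP => _; rewrite ?scale0r.
  rewrite dsumZE /truncate ti; case: ifP => // ji.
  by rewrite (fam j).1 ?ji // scaler0.
- exact: bas.
Qed.

(** A basis can be made to contain a basis of the subspace [U]. The vectors are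
treated by increasing key, and each is moved into [U], if possible, by adding a
combination of the preceding ones. A combination in [U] of the resulting vectors
can then only involve vectors of [U]: its last term could have been moved into
[U], hence lies in [U], and can be subtracted. *)
Lemma interval_basis_adapt m (J : finType) (p : J -> 'I_n * 'I_n) e (l : 'I_n)
    (U : V l -> Prop) :
  l.+1 = m :> nat -> U 0 -> (forall (a : k) u v, U u -> U v -> U (a *: u + v)) ->
  interval_basis m p e ->
  exists e', interval_basis m p e' /\
    forall a : J -> k, U (\sum_(j | in_interval (p j) l) a j *: e' j l) ->
      forall j, in_interval (p j) l -> a j != 0 -> U (e' j l).
Proof.
move=> lm U0 Ulin ibe.
pose older j j' := (birth_key (p j').1 <= birth_key (p j).1)%R.
pose s := sort older (enum (fun j => in_interval (p j) l)).
have sE j : (j \in s) = in_interval (p j) l by rewrite mem_sort mem_enum.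
have sU : uniq s by rewrite sort_uniq enum_uniq.
have ss : sorted older s by apply: sort_sorted => i j; rewrite /older; lia.
have otr : transitive older by move=> i j h; rewrite /older; lia.
have [e' [ibe' eP]] : exists e', interval_basis m p e' /\
    forall a : J -> k, U (\sum_(j in s) a j *: e' j l) ->
      forall j, j \in s -> a j != 0 -> U (e' j l).
  have sl j : j \in s -> in_interval (p j) l by rewrite sE.
  elim: s {sE} sU ss sl => [|t s IH] /=; first by exists e.
  move=> /andP[ts us] /[dup] /(order_path_min otr)/allP smin /path_sorted ss sl.
  have dE j : j \in t :: s -> (p j).2 = l.
    move=> /sl /andP[_ jl]; apply: val_inj => /=.
    by have := ib_valid ibe j; lia.
  have {IH} [j js|e1 [ib1 e1P]] := IH us ss.
    by apply: sl; rewrite inE js orbT.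
  have sumE (e2 : J -> dsum (fun i => V i)) (a : J -> k) :
      (forall j, j \in s -> e2 j = e1 j) ->
      \sum_(j in t :: s) a j *: e2 j l =
      a t *: e2 t l + \sum_(j in s) a j *: e1 j l.
    move=> e12; rewrite (bigD1 t) ?inE ?eqxx //=; congr (_ + _).
    apply: eq_big => [j|j].
      by rewrite inE; case: eqP => [->|_] //=; rewrite ?(negbTE ts) // andbT.
    by rewrite inE; case: eqP => //= _; rewrite andbT => js; rewrite e12.
  have subU u v : U (u + v) -> U u -> U v.
    by move=> uv uu; have := Ulin (-1) _ _ uu uv; rewrite scaleN1r addKr.
  have [[c cU]|nc] :=
      EM (exists c : J -> k, U (e1 t l + \sum_(j in s) c j *: e1 j l)).
    set e2 := fun j => if j == t then
      e1 t + \sum_(j' in s) c j' *: truncate (p t) (e1 j') else e1 j.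
    have e2E j : j \in s -> e2 j = e1 j.
      by rewrite /e2; case: eqP => // ->; rewrite (negbTE ts).
    have e2t : U (e2 t l).
      rewrite /e2 eqxx dsumDE dsum_bigE.
      under eq_bigr => j _ do rewrite dsumZE /truncate sl ?inE ?eqxx //.
      exact: cU.
    (* Here [e1 t] can be moved into [U]. *)
    exists e2; split.
      apply: interval_basis_adapt_step => //.
        by rewrite dE ?inE ?eqxx.
      move=> j js; split; last exact: smin.
      by rewrite !dE ?inE ?eqxx // js orbT.
    move=> a; rewrite sumE // => aU j; rewrite inE => /orP[/eqP ->|js] // aj.
    rewrite e2E //; apply: e1P aj => //; apply: subU aU _.
    by rewrite -[_ *: _]addr0; apply: Ulin.
  (* No combination in [U] involves [e1 t]. *)
  exists e1; split=> // a; rewrite sumE // => aU.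
  have at0 : a t = 0.
    apply: contrapT => /eqP at0; apply: nc; exists (fun j => (a t)^-1 * a j).
    under eq_bigr do rewrite -scalerA.
    rewrite -scaler_sumr -[e1 t l]scale1r -(mulVf at0) -scalerA -scalerDr.
    by rewrite -[_ *: _]addr0; apply: Ulin.
  move: aU; rewrite at0 scale0r add0r => /e1P aU j; rewrite inE.
  by case/orP=> [/eqP ->|]; [rewrite at0 eqxx | exact: aU].
exists e'; split=> // a aU j jl; apply: eP; last by rewrite sE.
by move: aU; congr U; apply: eq_bigl => j'; rewrite sE.
Qed.

(** The families in [Y] are prolonged by the vectors [y] to the level [m], the
other ones end before it, and the vectors [g] are born there. *)
Lemma interval_basis_extend (m : 'I_n) (J : finType) (p : J -> 'I_n * 'I_n) e
    (Y : pred J) (y : J -> V m) q (g : 'I_q -> V m) :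
  interval_basis m p e ->
  (forall j, Y j -> (p j).2.+1 = m :> nat) ->
  (forall l (h : T l m), m = l.+1 :> nat -> forall j, (p j).2 = l ->
    zmap V (connect1 h) (e j l) = if Y j then y j else 0) ->
  (forall l (h : T m l), m = l.+1 :> nat ->
    (forall j, Y j -> zmap V (connect1 h) (y j) = e j l) /\
    (forall i, zmap V (connect1 h) (g i) = 0)) ->
  basis_on (fun z : J + 'I_q => if z is inl j then Y j else true)
           (fun z => match z with inl j => y j | inr i => g i end) ->
  exists (J' : finType) (p' : J' -> 'I_n * 'I_n) e', interval_basis m.+1 p' e'.
Proof.
move=> [vld fam bas] Ym fwd bwd ygb.
pose p' (z : J + 'I_q) := match z with
  | inl j => ((p j).1, if Y j then m else (p j).2) | inr i => (m, m) end.
pose e' (z : J + 'I_q) : dsum (fun i => V i) := match z with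
  | inl j => e j + (if Y j then dsum_in (y j) else 0)
  | inr i => dsum_in (g i) end.
exists (J + 'I_q)%type, p', e'.
have vld' (z : J + 'I_q) : ((p' z).1 <= (p' z).2 < m.+1)%N.
  case: z => [j|i] /=; last by rewrite leqnn ltnSn.
  by have := vld j; case: ifP => _; lia.
have ejm j : e j m = 0.
  by apply: (fam j).1; have := vld j; rewrite /in_interval; lia.
have ltE (z : J + 'I_q) (i : 'I_n) : (i < m)%N ->
    in_interval (p' z) i = if z is inl j then in_interval (p j) i else false.
  case: z => [j|i'] im; last by rewrite /in_interval /=; lia.
  rewrite /in_interval /=; case: ifP => // /Ym; lia.
have mE (z : J + 'I_q) : in_interval (p' z) m = if z is inl j then Y j else true.
  case: z => [j|i] /=; rewrite /in_interval /= ?leqnn //.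
  by have := vld j; case: ifP => _; lia.
have elt (z : J + 'I_q) (i : 'I_n) : (i < m)%N ->
    e' z i = if z is inl j then e j i else 0.
  move=> im; have mi : m != i by rewrite -val_eqE /=; lia.
  case: z => [j|i'] /=; last by rewrite dsum_in_neq.
  by rewrite dsumDE; case: ifP => _; rewrite ?dsum_in_neq ?addr0.
have em (z : J + 'I_q) : e' z m =
    match z with inl j => if Y j then y j else 0 | inr i => g i end.
  case: z => [j|i] /=; last by rewrite dsum_in_id.
  by rewrite dsumDE ejm add0r; case: ifP => _; rewrite ?dsum_in_id.
have cmp (i : 'I_n) : [\/ (i < m)%N, i = m | (m < i)%N].
  case: (ltngtP i m) => [|h|/val_inj h]; by constructor.
split=> // [z|i].
  split=> [i ip|i j h].
    have [im|im|mi] := cmp i.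
    - move: ip; rewrite ltE // elt //; case: z => // j; exact: (fam j).1.
    - by move: ip; rewrite im mE em; case: z => // j /negbTE ->.
    - have mi' : m != i by rewrite -val_eqE /=; lia.
      case: z ip => [j|i'] ip /=; last by rewrite dsum_in_neq.
      rewrite dsumDE (fam j).1; last by have := vld j; rewrite /in_interval; lia.
      by case: ifP => _; rewrite ?dsum_in_neq ?addr0.
  rewrite !ltnS => lim ljm ix.
  have [im|im|] := cmp i; last by lia.
    have [jm|jm|] := cmp j; last by lia.
      rewrite !elt //; move: ix; rewrite ltE //; case: z => [z|i'] // ix.
      exact: (fam z).2.
    move: ix; rewrite ltE // elt //; case: z => // z ix.
    rewrite jm in h *; rewrite em.
    have ml : m = i.+1 :> nat by have := zedge_adj h; lia.
    have xd : (p z).2 = i.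
      by apply: val_inj => /=; move: ix; have := vld z; rewrite /in_interval; lia.
    exact: fwd.
  rewrite im in h ix *; rewrite em.
  have ml : m = j.+1 :> nat by have := zedge_adj h; lia.
  rewrite elt; last by lia.
  have [yE gE] := bwd _ h ml.
  by move: ix; rewrite mE; case: z => [z|i'] // Yx; rewrite Yx yE.
rewrite ltnS; have [im _|-> _|] := cmp i; last by lia.
  have [fr sp] := bas i im.
  have E (a : J + 'I_q -> k) : \sum_(z | in_interval (p' z) i) a z *: e' z i =
      \sum_(j | in_interval (p j) i) a (inl j) *: e j i.
    rewrite big_sumType /= [X in _ + X]big_pred0 => [|i'].
      rewrite addr0; apply: eq_big => [j|j _]; first exact: (ltE (inl j)).
      by congr (_ *: _); exact: (elt (inl j)).
    exact: (ltE (inr i')).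
  split=> [a|v].
    rewrite E => /fr a0 z; rewrite ltE //; case: z => // j; exact: a0.
  have [a ->] := sp v; exists (fun z => if z is inl j then a j else 0).
  by rewrite E.
apply: eq_basis_on ygb => [z|z]; first by rewrite mE.
by rewrite em; case: z => // j ->.
Qed.

End Existence.

Definition linear_pack (k : pzRingType) (U W : lmodType k) (f : U -> W)
    (flin : linear f) : {linear U -> W} :=
  HB.pack f (GRing.isLinear.Build k U W *:%R f flin).

Section Decomposition.
Variables (k : fieldType) (n : nat) (T : zigzag n) (V : zzmodule k T).

Lemma zmap_edge (M : zzmodule k T) i j (h h' : connect T i j) (v : M i) :
  zmap M h v = zmap M h' v.
Proof. by rewrite (bool_irrelevance h h'). Qed.

Lemma free_on_sub (W : lmodType k) (J : finType) (P Q : pred J) (e : J -> W) :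
  (forall j, Q j -> P j) -> free_on P e -> free_on Q e.
Proof.
move=> QP fr a a0 j Qj.
have := fr (fun j => if Q j then a j else 0) _ j (QP j Qj); rewrite Qj; apply.
rewrite -[RHS]a0 big_mkcond [RHS]big_mkcond /=; apply: eq_bigr => i _.
by have := QP i; case: (Q i) => [->|_] //; rewrite scale0r if_same.
Qed.

(** For an arrow that enters the new level, the basis of the preceding space is
adapted to the kernel: families in the kernel end, and the images of the other
ones are free. For an arrow that leaves the new level, it is adapted to the image:
families in the image are lifted, the other ones end, and the kernel provides the
births. *)
Lemma interval_basis_exists m : (m <= n)%N ->
  exists (J : finType) (p : J -> 'I_n * 'I_n) (e : J -> dsum (fun i => V i)),
    interval_basis m p e.
Proof.
elim: m => [_|m IH mn].
  exists void, (fun x : void => match x with end), (fun x : void => match x with end).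
  by split=> // -[].
have [J [p [e ibe]]] := IH (ltnW mn); pose mo : 'I_n := Ordinal mn.
case: m => [|m] in mn mo ibe {IH} *.
  have fr : free_on pred0 (fun _ : J => 0 : V mo) by [].
  have [|q [g [_ bg]]] :=
    extend_to_basis (G := fun _ => True) (zspace_fin_dim V mo) fr.
    by move=> v; exists (fun=> 0), v; split=> //; rewrite big_pred0 ?add0r.
  by apply: (@interval_basis_extend _ _ _ V mo J p e pred0
    (fun _ : J => 0 : V mo) q g ibe _ _ _ bg).
have ln : (m < n)%N by lia.
pose l : 'I_n := Ordinal ln.
have leq_l (l' : 'I_n) : mo = l'.+1 :> nat -> l' = l.
  by move=> ml; apply: val_inj => /=; move: ml => /=; lia.
have aliveE j : in_interval (p j) l = ((p j).2 == l).
  by have := ib_valid ibe j; rewrite /in_interval -val_eqE /=; lia.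
have := zedge_or T (erefl : mo = l.+1 :> nat).
case: (boolP (T l mo)) => [h hN|_ h].
  have nh : ~~ T mo l by [].
  pose f := zmap V (connect1 h).
  have [||e1 [ib1 e1U]] := interval_basis_adapt (l := l)
    (U := fun v => f v = 0) erefl _ _ ibe.
  - exact: linear0.
  - by move=> a u v u0 v0; rewrite linearP u0 v0 scaler0 addr0.
  pose Y j := ((p j).2 == l) && (f (e1 j l) != 0).
  have Yfree : free_on Y (fun j => f (e1 j l)).
    move=> a a0 j /[dup] Yj /andP[jl fj]; apply: contrapT => /eqP aj.
    have Yl i : Y i -> in_interval (p i) l by rewrite aliveE => /andP[].
    move/eqP: fj; apply; pose c i := if Y i then a i else 0.
    have cj : c j != 0 by rewrite /c Yj.
    apply: (e1U c) cj; last exact: Yl.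
    rewrite linear_sum -[RHS]a0 big_mkcond [RHS]big_mkcond /=.
    apply: eq_bigr => i _; rewrite /c; case: ifP => [_|il]; last first.
      by case: ifP => // /Yl; rewrite il.
    by rewrite linearZ_LR; case: ifP => // _; rewrite scale0r.
  have [|q [g [_ bg]]] :=
      extend_to_basis (G := fun _ => True) (zspace_fin_dim V mo) Yfree.
    move=> v; exists (fun=> 0), v; split=> //.
    by rewrite big1 ?add0r // => j _; rewrite scale0r.
  apply: (@interval_basis_extend _ _ _ V mo J p e1 Y _ q g ib1 _ _ _ bg).
  - by move=> j /andP[/eqP -> _].
  - move=> l' h' /leq_l ll; subst l' => j jl.
    rewrite /Y jl eqxx /=.
    have -> : zmap V (connect1 h') (e1 j l) = f (e1 j l) by exact: zmap_edge.
    by case: eqP.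
  - by move=> l' h' /leq_l ll; subst l'; rewrite h' in nh.
rewrite addFb in h; pose f := zmap V (connect1 h).
have nh : ~~ T l mo := zedge_asym h.
have [||e1 [ib1 e1U]] := interval_basis_adapt (l := l)
  (U := fun v => exists w, f w = v) erefl _ _ ibe.
- by exists 0; exact: linear0.
- by move=> a u v [w <-] [z <-]; exists (a *: w + z); rewrite linearP.
pose Y j := ((p j).2 == l) && `[< exists w, f w = e1 j l >].
have [y yP] : exists y : J -> V mo, forall j, Y j -> f (y j) = e1 j l.
  have H j : exists w, Y j -> f w = e1 j l.
    have [|Yj] := boolP (Y j); last by exists 0.
    by move=> /andP[_ /asboolP[w fw]]; exists w.
  by have [y yP] := choice H; exists y.
have Yl i : Y i -> in_interval (p i) l by rewrite aliveE => /andP[].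
have [e1free e1span] := ib_basis ib1 (ltnSn m : (l < m.+1)%N).
have fsum (a : J -> k) :
    f (\sum_(j | Y j) a j *: y j) = \sum_(j | Y j) a j *: e1 j l.
  by rewrite linear_sum; apply: eq_bigr => j Yj; rewrite linearZ_LR yP.
have Yfree : free_on Y y.
  move=> a a0; apply: (free_on_sub Yl e1free).
  by rewrite -fsum a0 linear0.
have [|q [g [gG bg]]] :=
    extend_to_basis (G := fun w => f w = 0) (zspace_fin_dim V mo) Yfree.
  move=> v; have [a aP] := e1span (f v).
  exists a, (v - \sum_(j | Y j) a j *: y j); split; last by rewrite addrC subrK.
  rewrite linearB fsum aP big_mkcond [X in _ - X]big_mkcond /=.
  apply/eqP; rewrite subr_eq0; apply/eqP/eq_bigr => j _.
  case: ifP => [jl|jl]; last by case: ifP => // /Yl; rewrite jl.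
  case: ifP => // /negbT Yj.
  have [->|aj] := eqVneq (a j) 0; first by rewrite scale0r.
  case/negP: Yj; rewrite /Y -aliveE jl; apply/asboolP.
  by apply: (e1U a) aj => //; rewrite -aP; exists v.
apply: (@interval_basis_extend _ _ _ V mo J p e1 Y y q g ib1 _ _ _ bg).
- by move=> j /andP[/eqP -> _].
- by move=> l' h' /leq_l ll; subst l'; rewrite h' in nh.
- move=> l' h' /leq_l ll; subst l'; split=> [j Yj|i].
    by rewrite -(yP j Yj); exact: zmap_edge.
  by rewrite -(gG i); exact: zmap_edge.
Qed.

Lemma zziso_of_edges (M N : zzmodule k T) (f : forall i, {linear M i -> N i}) :
  (forall i, bijective (f i)) ->
  (forall i j (h : T i j) v,
     f j (zmap M (connect1 h) v) = zmap N (connect1 h) (f i v)) ->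
  zziso M N.
Proof.
move=> fbij fedge; exists f; split=> // i j h v.
have [s] := connectP h; elim: s i h v => [|l s IH] i h v /=.
  by move=> _ ij; subst j; rewrite !zmap_id.
move=> /andP[il lp] jE; have lj : connect T l j by apply/connectP; exists s.
by rewrite !(zmap_comp (connect1 il) lj h) IH // fedge.
Qed.

(** The isomorphism sends a vector to its coordinates in an interval basis; the
coordinate of a family that is not alive has no room in the interval module. *)
Lemma interval_decomposition_exists : exists s, interval_decomposition V s.
Proof.
have [J [p [e [vld fam bas]]]] := interval_basis_exists (leqnn n).
pose s := [seq p j | j <- enum J].
pose idx (l : 'I_(size s)) : J :=
  tnth (in_tuple (enum J)) (cast_ord (size_map p (enum J)) l).
have idxE l : tnth (in_tuple s) l = p (idx l).
  have x0 := idx l; rewrite (tnth_nth (p x0)) /idx (tnth_nth x0) /= (nth_map x0) //.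
  by rewrite -(size_map p) ltn_ord.
have idx_bij : bijective idx.
  have iK j : (index j (enum J) < size s)%N by rewrite size_map index_mem mem_enum.
  exists (fun j => Ordinal (iK j)) => [l|j].
    apply: val_inj; rewrite /= /idx (tnth_nth (idx l)) /= index_uniq ?enum_uniq //.
    by rewrite -(size_map p) ltn_ord.
  by rewrite /idx (tnth_nth j) /= nth_index // mem_enum.
exists s; split.
  by apply/allP => x /mapP[j _ ->]; have /andP[] := vld j.
have coordE (i : 'I_n) : exists c : V i -> J -> k, forall v,
    v = \sum_(j | in_interval (p j) i) c v j *: e j i.
  by have [_ sp] := bas i (ltn_ord i); have [c cP] := choice sp; exists c.
pose c (i : 'I_n) : V i -> J -> k := sval (cid (coordE i)).
have cP i v : v = \sum_(j | in_interval (p j) i) c i v j *: e j i.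
  exact: (svalP (cid (coordE i)) v).
have cuniq i v (a : J -> k) j : v = \sum_(j | in_interval (p j) i) a j *: e j i ->
    in_interval (p j) i -> c i v j = a j.
  move=> va ji; apply: (free_on_eq (proj1 (bas i (ltn_ord i)))) ji.
  by rewrite -cP.
pose F (i : 'I_n) (v : V i) : zzsum (fun j : 'I_(size s) =>
    interval_module k T (tnth (in_tuple s) j)) i :=
  fun l => const_mx (c i v (idx l)).
have Flin i : linear (F i).
  move=> a u v; apply/functional_extensionality_dep => l.
  apply/rowP => x; rewrite !mxE.
  have li : in_interval (p (idx l)) i.
    by rewrite -idxE; case: (in_interval _ i) x => // -[].
  apply: (cuniq i _ (fun j => a * c i u j + c i v j)) => //.
  under eq_bigr do rewrite scalerDl -scalerA.
  by rewrite big_split -scaler_sumr /= -!cP.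
pose FL i := linear_pack (Flin i).
apply: (zziso_of_edges (f := FL)) => [i|i j h v].
  have [g gK Kg] := idx_bij.
  pose G (u : zzsum (fun j : 'I_(size s) =>
      interval_module k T (tnth (in_tuple s) j)) i) : V i :=
    \sum_(j | in_interval (p j) i) (\sum_x u (g j) 0 x) *: e j i.
  have sum_in (q : 'I_n * 'I_n) (x : k) (w : 'rV[k]_(in_interval q i)) :
     in_interval q i -> (forall y, w 0 y = x) -> \sum_y w 0 y = x.
    by case: (in_interval q i) w => // w _ wx; rewrite big_ord1.
  exists G => [v|u].
    rewrite [RHS]cP /G; apply: eq_bigr => j ji; congr (_ *: _).
    apply: sum_in => [|y]; first by rewrite idxE Kg.
    by rewrite mxE Kg.
  apply/functional_extensionality_dep => l; apply/rowP => x; rewrite mxE.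
  have li : in_interval (p (idx l)) i.
    by rewrite -idxE; case: (in_interval _ i) x => // -[].
  rewrite (cuniq i _ (fun j => \sum_x u (g j) 0 x)) //= gK.
  apply: sum_in => [|y]; first by rewrite idxE.
  congr (u l 0 _); apply: val_inj => /=.
  by case: (in_interval _ _) x y => [[[]//]|[]//] ? [[]].
apply/functional_extensionality_dep => l; apply/rowP => x.
have lj : in_interval (p (idx l)) j.
  by rewrite -idxE; case: (in_interval _ j) x => // -[].
rewrite /= /F mxE [RHS]mxE.
under [RHS]eq_bigr do rewrite !mxE.
rewrite (cuniq j _ (fun j' => if in_interval (p j') i then c i v j' else 0)) //.
  rewrite -idxE; case: (in_interval _ i); last by rewrite big_ord0.
  rewrite big_ord1; move: x; rewrite idxE lj => -[[|//] ?] /=.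
  by rewrite mulr1.
rewrite {1}(cP i v) linear_sum big_mkcond [RHS]big_mkcond /=.
apply: eq_bigr => j' _; case: ifP => ji.
  rewrite linearZ_LR (fam j').2 //; case: ifP => // /negbT /((fam j').1) ->.
  by rewrite scaler0.
by rewrite scale0r if_same.
Qed.

End Decomposition.

(** * The generalized rank over an interval *)

Section GeneralizedRank.
Variables (k : fieldType) (n : nat) (T : zigzag n) (p : 'I_n * 'I_n).

Definition is_section (M : zzmodule k T) (v : forall i, M i) : Prop :=
  forall i j (h : T i j), in_interval p i -> in_interval p j ->
    zmap M (connect1 h) (v i) = v j.

Definition is_cosection (M : zzmodule k T) (phi : forall i, {linear M i -> k^o}) :
  Prop :=
  forall i j (h : T i j), in_interval p i -> in_interval p j ->
    forall x, phi j (zmap M (connect1 h) x) = phi i x.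

(** The pairing of sections and cosections has rank at least [r]: it restricts to
the identity matrix of size [r]. *)
Definition rank_ge (M : zzmodule k T) (r : nat) : Prop :=
  exists (v : 'I_r -> forall i, M i)
         (phi : 'I_r -> forall i, {linear M i -> k^o}),
    (forall x, is_section (v x)) /\ (forall x, is_cosection (phi x)) /\
    forall x y, phi x p.1 (v y p.1) = (x == y)%:R.

Lemma pairing_const (M : zzmodule k T) v phi (i j : 'I_n) :
  is_section (M := M) v -> is_cosection phi -> in_interval p i -> in_interval p j ->
  phi i (v i) = phi j (v j).
Proof.
move=> vs ps; suff H (x : nat) (i' j' : 'I_n) : j' = (i' + x)%N :> nat ->
    in_interval p i' -> in_interval p j' -> phi i' (v i') = phi j' (v j').
  have [le|/ltnW le] := leqP i j => ip jp.
    by apply: (H (j - i)%N); rewrite ?subnKC.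
  by apply/esym/(H (i - j)%N); rewrite ?subnKC.
elim: x j' => [|x IH] j' jE ip jp.
  by have -> : j' = i' by apply: val_inj => /=; lia.
have ln : (i' + x < n)%N by have := ltn_ord j'; lia.
have lp : in_interval p (Ordinal ln).
  by move: ip jp; rewrite /in_interval /=; lia.
rewrite (IH (Ordinal ln)) //.
have jE' : j' = (Ordinal ln).+1 :> nat by rewrite /= jE addnS.
have := zedge_or T jE'; case: (boolP (T _ _)) => [h _|_ h].
  by rewrite -(vs _ _ h lp jp) (ps _ _ h lp jp).
rewrite addFb in h.
by rewrite -(vs _ _ h jp lp) (ps _ _ h jp lp).
Qed.

Lemma rank_ge_zziso (M N : zzmodule k T) r :
  zziso M N -> rank_ge M r <-> rank_ge N r.
Proof.
move=> [f [fbij fh]].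
have ginv i : exists g : N i -> M i, cancel (f i) g /\ cancel g (f i).
  by have [g fK gK] := fbij i; exists g.
pose g i := sval (cid (ginv i)).
have fK i : cancel (f i) (g i) by case: (svalP (cid (ginv i))).
have gK i : cancel (g i) (f i) by case: (svalP (cid (ginv i))).
have glin i : linear (g i).
  by move=> a x y; apply: (can_inj (fK i)); rewrite linearP !gK.
have gh i j (h : connect T i j) x : g j (zmap N h x) = zmap M h (g i x).
  by apply: (can_inj (fK j)); rewrite fh !gK.
split=> -[v [phi [vs [ps pv]]]].
  exists (fun x i => f i (v x i)), (fun x i => phi x i \o linear_pack (glin i)).
  split; [|split] => [x i j h ip jp|x i j h ip jp y|x y].
  - by rewrite -fh vs.
  - by rewrite /= gh ps.
  - by rewrite /= fK pv.
exists (fun x i => g i (v x i)), (fun x i => phi x i \o f i).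
split; [|split] => [x i j h ip jp|x i j h ip jp y|x y].
- by rewrite -gh vs.
- by rewrite /= fh ps.
- by rewrite /= gK pv.
Qed.

(** An identity matrix that factors through dimension [#|P|] has at most that size.
*)
Lemma card_ge_of_factorization (C : finType) (P : pred C) r (A : 'I_r -> C -> k)
    (B : C -> 'I_r -> k) :
  (forall x y, \sum_(c | P c) A x c * B c y = (x == y)%:R) -> (r <= #|P|)%N.
Proof.
move=> AB; pose MA := \matrix_(x < r, c < #|P|) A x (enum_val c).
pose MB := \matrix_(c < #|P|, y < r) B (enum_val c) y.
have E : MA *m MB = 1%:M.
  apply/matrixP => x y; rewrite !mxE -AB (big_enum_val (A := P)).
  by apply: eq_bigr => c _; rewrite !mxE.
have <- : \rank (MA *m MB) = r by rewrite E mxrank1.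
exact: leq_trans (mxrankM_maxl _ _) (rank_leq_col _).
Qed.

Definition covers (q : 'I_n * 'I_n) : bool := (q.1 <= p.1)%N && (p.2 <= q.2)%N.

Lemma covers_in_interval q i : covers q -> in_interval p i -> in_interval q i.
Proof. by rewrite /covers /in_interval; lia. Qed.

Lemma ispace_eq0 (q : 'I_n * 'I_n) (i : 'I_n) (w : ispace k q i) :
  ~~ in_interval q i -> w = 0.
Proof.
by rewrite /ispace in w *; case: (in_interval _ i) w => // w _; exact: thinmx0.
Qed.

Lemma imap_sum (q : 'I_n * 'I_n) (i j : 'I_n) (h : connect T i j) (w : ispace k q i) :
  in_interval q i -> in_interval q j ->
  \sum_y imap k q h w 0 y = \sum_y w 0 y.
Proof.
rewrite /imap /= /ispace in w *; case: (in_interval _ j) => //.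
case: (in_interval _ i) w => // w _ _.
by rewrite !big_ord1 mxE big_ord1 mxE mulr1.
Qed.

Variable s : seq ('I_n * 'I_n).
Local Notation Is :=
  (fun j : 'I_(size s) => interval_module k T (tnth (in_tuple s) j)).
Local Notation cov := (fun j : 'I_(size s) => covers (tnth (in_tuple s) j)).

Hypothesis p_valid : (p.1 <= p.2)%N.

Let p1_in : in_interval p p.1. Proof. by rewrite /in_interval leqnn. Qed.
Let p2_in : in_interval p p.2. Proof. by rewrite /in_interval leqnn andbT. Qed.

(** Each bar that covers [p] contributes its constant section, and its coordinate as
cosection. *)
Lemma rank_ge_zzsum r : (r <= #|cov|)%N -> rank_ge (zzsum Is) r.
Proof.
move=> le; pose c (x : 'I_r) : 'I_(size s) := enum_val (widen_ord le x).
have cinj : injective c by move=> x y /enum_val_inj /(congr1 val) /= /val_inj.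
have cc x : cov (c x) by have := enum_valP (widen_ord le x).
pose v x i : zzsum Is i := fun j => const_mx (j == c x)%:R.
pose phi (x : 'I_r) i (u : zzsum Is i) : k^o := \sum_y u (c x) 0 y.
have philin x i : linear (@phi x i).
  move=> a u w; rewrite /phi scaler_sumr -big_split /=; apply: eq_bigr => y _.
  by rewrite mxE [X in X + _]mxE.
exists v, (fun x i => linear_pack (philin x i)); split; [|split].
- move=> x i j h ip jp; apply/functional_extensionality_dep => l.
  apply/rowP => y; rewrite [LHS]mxE [RHS]mxE.
  under eq_bigr do rewrite [const_mx _ _ _]mxE.
  have [lx|_] := eqVneq l (c x); last by rewrite big1 // => ? _; rewrite mul0r.
  subst l; have ic := covers_in_interval (cc x) ip.
  have jc := covers_in_interval (cc x) jp.
  case: (in_interval _ j) jc y => // _ y.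
  case: (in_interval _ i) ic => // _; rewrite big_ord1 mxE.
  by case: y => -[|//] ? /=; rewrite mulr1.
- move=> x i j h ip jp u.
  by apply: imap_sum; [exact: covers_in_interval ip | exact: covers_in_interval jp].
- move=> x y; rewrite /= /phi.
  under eq_bigr do rewrite mxE.
  have : in_interval (tnth (in_tuple s) (c x)) p.1.
    exact: covers_in_interval (cc x) p1_in.
  by case: (in_interval _ _) => // _; rewrite big_ord1 (inj_eq cinj).
Qed.

(** The pairing of a section and a cosection is the sum over the bars of the
pairings of their components. For a bar that does not cover [p] it is 0, as can be
read off at an end of [p] outside the bar; a bar that covers [p] is one-dimensional
at [p.1]. *)
Lemma rank_ge_zzsum_le r : rank_ge (zzsum Is) r -> (r <= #|cov|)%N.
Proof.
move=> [v [phi [vs [ps pv]]]].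
pose comp (j : 'I_(size s)) i (w : Is j i) : zzsum Is i :=
  @dsum_in k _ (fun j => Is j i : lmodType k) j w.
have complin j i : linear (comp j i).
  exact: (@dsum_in_linear k _ (fun j => Is j i : lmodType k) j).
have phij (x : 'I_r) j i : linear (fun w : Is j i => phi x i (comp j i w) : k^o).
  move=> a u w; rewrite -linearP; congr (phi x i _); by rewrite complin.
have pj x j : is_cosection (fun i => linear_pack (phij x j i)).
  move=> i i' h ip ip' w /=; rewrite -(ps x _ _ h ip ip'); congr (phi x _ _).
  apply/functional_extensionality_dep => l /=; rewrite /dsum_map /= /comp.
  have [jl|jl] := eqVneq j l; first by subst l; rewrite !dsum_in_id.
  by rewrite !dsum_in_neq // mul0mx.
have vj y j : is_section (M := Is j) (fun i => v y i j).
  by move=> i i' h ip ip'; rewrite -(vs y _ _ h ip ip').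
apply: (card_ge_of_factorization (A := fun x j => phi x p.1 (comp j p.1 (const_mx 1)))
  (B := fun j y => \sum_z v y p.1 j 0 z)) => x y.
rewrite -pv [in RHS](dsum_in_sum (v y p.1)) linear_sum [RHS](bigID cov) /=.
rewrite [X in _ = _ + X]big1 ?addr0 => [|j nc]; last first.
  have [i ip ij] : exists2 i, in_interval p i & ~~ in_interval (tnth (in_tuple s) j) i.
    move: nc; rewrite /covers negb_and => /orP[nc|nc].
      by exists p.1 => //; rewrite /in_interval (negbTE nc).
    by exists p.2 => //; rewrite /in_interval (negbTE nc) andbF.
  rewrite [LHS](pairing_const (vj y j) (pj x j) p1_in ip) /=.
  suff -> : v y i j = 0 :> Is j i by exact: (linear0 (linear_pack (phij x j i))).
  exact: ispace_eq0.
apply: eq_bigr => j jc.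
suff {2}-> : v y p.1 j = (\sum_z v y p.1 j 0 z) *: (const_mx 1 : Is j p.1).
  by rewrite [RHS](linearZ_LR (linear_pack (phij x j p.1))) /= mulrC.
have := covers_in_interval jc p1_in; move: (v y p.1 j); rewrite /= /ispace.
case: (in_interval _ _) => // w _; apply/rowP => z.
by rewrite !mxE big_ord1 mulr1 ord1.
Qed.

End GeneralizedRank.

(** * Barcodes are determined by generalized ranks *)

Lemma card_tnth (I : eqType) (s : seq I) (P : pred I) :
  #|fun j : 'I_(size s) => P (tnth (in_tuple s) j)| = count P s.
Proof. by rewrite -sum1_card -sum1_count [RHS]big_tnth. Qed.

Lemma count_sum_count_mem (I : finType) (s : seq I) (P : pred I) :
  count P s = (\sum_(x | P x) count_mem x s)%N.
Proof.
elim: s => [|y s IH] /=; first by rewrite big1.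
rewrite big_split /= -IH; congr (_ + _)%N.
case: (boolP (P y)) => Py.
  rewrite (bigD1 y) //= eqxx big1 // => x /andP[_ xy].
  by rewrite eq_sym (negbTE xy).
by rewrite big1 // => x Px; case: eqP => // yx; rewrite yx Px in Py.
Qed.

(** The multiplicity of [p] is the number of bars that cover [p], minus the
multiplicities of the strictly longer intervals that cover it; so the claim follows
by induction, from the longest intervals down. *)
Lemma perm_eq_of_covers n (s t : seq ('I_n * 'I_n)) :
  all (fun q : 'I_n * 'I_n => (q.1 <= q.2)%N) s ->
  all (fun q : 'I_n * 'I_n => (q.1 <= q.2)%N) t ->
  (forall p : 'I_n * 'I_n, (p.1 <= p.2)%N ->
    count (covers p) s = count (covers p) t) ->
  perm_eq s t.
Proof.
move=> sv tv st.
suff H (p : 'I_n * 'I_n) : count_mem p s = count_mem p t.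
  by apply/allP => p _; apply/eqP.
have [pv|pv] := leqP p.1 p.2; last first.
  have nin (u : seq ('I_n * 'I_n)) :
      all (fun q : 'I_n * 'I_n => (q.1 <= q.2)%N) u -> count_mem p u = 0%N.
    by move=> /allP uv; apply/count_memPn/negP => /uv /=; rewrite leqNgt pv.
  by rewrite !nin.
have [m] := ubnP (n - (p.2 - p.1))%N; elim: m p pv => // m IH p pv pm.
have := st p pv; rewrite (count_sum_count_mem s) (count_sum_count_mem t).
have pp : covers p p by rewrite /covers !leqnn.
rewrite (bigD1 p pp) [RHS](bigD1 p pp) /=.
rewrite (eq_bigr (fun q => count_mem q t)) => [/addIn //|/= q /andP[]].
move=> /andP[qp pq] neq.
have ne : (q.1 != p.1 :> nat) || (q.2 != p.2 :> nat).
  by rewrite -negb_and; apply: contra neq; rewrite -pair_eqE.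
apply: IH; first exact: leq_trans qp (leq_trans pv pq).
move: (ltn_ord q.2) qp pq ne pv pm.
by case: q {neq} => q1 q2 /=; lia.
Qed.

(** * Linear forms on degree zero homology *)

Section PointForm.
Variables (R : realType) (k : fieldType) (Y : topologicalType).
Implicit Types (c : chain R k Y 0) (s : simplex R Y 0).

Lemma class0_sum c : class0 c = \sum_(s <- dom c) coeff s c *: class0 << s >>.
Proof.
rewrite -{1}(freeg_sumE c) linear_sum; apply: eq_bigr => s _.
by rewrite freegUZ; exact: linearZ_LR.
Qed.

Lemma class0_face (t : simplex R Y 1) :
  class0 << face ord0 t >> = class0 << face ord_max t >>
    :> singular_homology R k Y 0.
Proof.
apply/class0P; exists << t >>; rewrite boundaryU /= big_ord_recl big_ord1.
by rewrite expr0 scale1r expr1 scaleN1r; congr (_ - << face _ t >>); apply: val_inj.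
Qed.

Variable h : simplex R Y 0 -> k.

(** A function on points that is constant along paths extends to a linear form on
[H_0]. The extension is defined on a representative cycle; it kills boundaries
because the boundary of a path is the difference of its ends. *)
Definition point_form (u : singular_homology R k Y 0) : k^o :=
  fglift (h : _ -> k^o) (hcycle_val (hrepr u)).

Hypothesis h_face : forall t : simplex R Y 1, h (face ord0 t) = h (face ord_max t).

Lemma point_form_class0 c : point_form (class0 c) = fglift (h : _ -> k^o) c.
Proof.
have /class0P[b cb] := class0_repr (class0 c).
rewrite /point_form; apply/eqP; rewrite -subr_eq0 -linearB cb; apply/eqP.
rewrite -(freeg_sumE b) !linear_sum big1 // => t _.
rewrite freegUZ !linearZ_LR boundaryU /= big_ord_recl big_ord1.
rewrite expr0 scale1r expr1 scaleN1r linearB /= !fglift1 h_face.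
rewrite [lift _ _](_ : _ = ord_max) ?subrr ?scaler0 //; exact: val_inj.
Qed.

Lemma point_form_point s : point_form (class0 << s >>) = h s.
Proof. by rewrite point_form_class0 fglift1. Qed.

Lemma point_form_is_linear : linear point_form.
Proof.
move=> a u v; rewrite -(class0_repr u) -(class0_repr v) -linearP.
by rewrite !point_form_class0 linearP.
Qed.

End PointForm.

(** * The generalized rank of degree zero homology *)

Section Linked.
Variables (R : realType) (n : nat) (T : zigzag n) (X : top_diagram R T).
Variable p : 'I_n * 'I_n.

Definition point : Type := {i : 'I_n & simplex R (X i) 0}.
Definition pt i (s : simplex R (X i) 0) : point := existT _ i s.

(** On the levels of [p] the classes are the path components of the telescope of the
spaces [X i] with [i] in [p]; no map links them to points at other levels. *)
Inductive linked : point -> point -> Prop :=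
| linked_refl x : linked x x
| linked_sym x y : linked x y -> linked y x
| linked_trans x y z : linked x y -> linked y z -> linked x z
| linked_path i (t : simplex R (X i) 1) :
    linked (pt (face ord0 t)) (pt (face ord_max t))
| linked_map i j (h : T i j) (s : simplex R (X i) 0) :
    in_interval p i -> in_interval p j ->
    linked (pt s) (pt (simplex_map (dmap X (connect1 h)) s)).

(** At least [r] components meet both [X p.1] and [X p.2]. *)
Definition spanning_ge (r : nat) : Prop :=
  exists (x : 'I_r -> simplex R (X p.1) 0) (z : 'I_r -> simplex R (X p.2) 0),
    (forall a, linked (pt (x a)) (pt (z a))) /\
    forall a b, linked (pt (x a)) (pt (x b)) -> a = b.

Variable k : fieldType.
Local Notation H := (H0 X k).

Lemma zmap_H0_point i j (h : connect T i j) (s : simplex R (X i) 0) :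
  zmap H h (class0 << s >>) = class0 << simplex_map (dmap X h) s >>.
Proof.
rewrite /= /class0 singular_homology_mapE; congr hclass; apply: val_inj => /=.
exact: chain_mapU.
Qed.

Definition indicator (x : point) i (s : simplex R (X i) 0) : k :=
  `[< linked x (pt s) >]%:R.

Lemma eq_linked x y z : linked y z -> `[< linked x y >] = `[< linked x z >].
Proof.
by move=> yz; apply/asboolP/asboolP => [xy|xz];
  [exact: linked_trans yz | exact: linked_trans (linked_sym yz)].
Qed.

Lemma indicator_face x i (t : simplex R (X i) 1) :
  indicator x (face ord0 t) = indicator x (face ord_max t).
Proof. by congr (nat_of_bool _)%:R; apply/eq_linked/linked_path. Qed.

Definition component_form x i : {linear H i -> k^o} :=
  linear_pack (point_form_is_linear (@indicator_face x i)).

Lemma component_form_point x i (s : simplex R (X i) 0) :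
  component_form x i (class0 << s >>) = `[< linked x (pt s) >]%:R.
Proof. exact/point_form_point/indicator_face. Qed.

Lemma homology_ind i (P : H i -> Prop) :
  P 0 -> (forall a s u, P u -> P (a *: class0 << s >> + u)) -> forall u, P u.
Proof.
move=> P0 Pl u; rewrite -(class0_repr u) class0_sum.
by elim/big_rec: _ => // s v _; exact: Pl.
Qed.

Lemma component_form_cosection x : is_cosection p (component_form x).
Proof.
move=> i j h ip jp; apply: homology_ind => [|a s u E]; first by rewrite !linear0.
rewrite [zmap _ _ _]linearP [LHS]linearP [RHS]linearP E; congr (_ *: _ + _).
rewrite [X in component_form x j X](zmap_H0_point (connect1 h) s).
rewrite !component_form_point; congr (nat_of_bool _)%:R.
by apply/esym/eq_linked/linked_map.
Qed.

Lemma cosection_linked (phi : forall i, {linear H i -> k^o}) x y :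
  is_cosection p phi -> linked x y ->
  phi (tag x) (class0 << tagged x >>) = phi (tag y) (class0 << tagged y >>).
Proof.
move=> ps; elim=> // {x y} [x y z _ -> _ ->|i t|i j h s ip jp] //=.
  by rewrite class0_face.
by rewrite -(ps _ _ h ip jp) zmap_H0_point.
Qed.

Definition point_vector (x : point) : dsum (fun i => H i : lmodType k) :=
  @dsum_in k _ (fun i => H i : lmodType k) (tag x) (class0 << tagged x >>).

(** A unit flow from [x] to [y] through the levels of [p]. Here [w i] is the class
that leaves level [i] to the right and [u i] the class that enters it from the
left; they differ by the source [x] and the sink [y], nothing crosses the ends of
[p], and what leaves a level enters the next one. *)
Definition flow (x y : point) : Prop :=
  exists w u : dsum (fun i => H i : lmodType k),
    [/\ u = w - point_vector x + point_vector y, w p.2 = 0, u p.1 = 0 &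
    forall i j (h : T i j), in_interval p i -> in_interval p j ->
      (j = i.+1 :> nat -> zmap H (connect1 h) (w i) = u j) /\
      (i = j.+1 :> nat -> zmap H (connect1 h) (u i) = w j)].

(** Flows add up along a chain of links and change sign when it is reversed. A link
by a map going right moves the point across one gap; a link by a map going left
crosses the gap with a negative sign. *)
Lemma linked_flow x y : linked x y -> flow x y.
Proof.
elim=> {x y} [x|x y _ [w [u [uE w0 u0 wu]]]|
  x y z _ [w [u [uE w0 u0 wu]]] _ [w' [u' [uE' w0' u0' wu']]]|
  i t|i j h s ip jp].
- exists 0, 0; rewrite add0r addNr; split=> // i j h _ _; split=> _; exact: linear0.
- exists (- w), (- u); split.
  + by rewrite uE !opprD opprK addrAC.
  + by rewrite -[LHS]/(- w p.2) w0 oppr0.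
  + by rewrite -[LHS]/(- u p.1) u0 oppr0.
  + move=> i j h ip jp; have [wu1 wu2] := wu i j h ip jp.
    by split=> ij; rewrite [LHS]linearN ?wu1 ?wu2.
- exists (w + w'), (u + u'); split.
  + have telescope (A : zmodType) (a b c d e : A) :
        (a - c + d) + (b - d + e) = (a + b) - c + e.
      by rewrite -!addrA; congr (_ + _); rewrite [d + _]addrCA addNKr addrCA.
    by rewrite uE uE' telescope.
  + by rewrite -[LHS]/(w p.2 + w' p.2) w0 w0' addr0.
  + by rewrite -[LHS]/(u p.1 + u' p.1) u0 u0' addr0.
  + move=> i j h ip jp; have [wu1 wu2] := wu i j h ip jp.
    have [wu1' wu2'] := wu' i j h ip jp.
    by split=> ij; rewrite [LHS]linearD ?wu1 ?wu2 // ?wu1' ?wu2'.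
- exists 0, 0; split=> // [|a b h _ _]; last by split=> _; exact: linear0.
  by rewrite /point_vector /= class0_face sub0r addNr.
set x := pt s; set y := pt _.
have out (z : point) l : tag z != l -> point_vector z l = 0 by exact: dsum_in_neq.
have xi : point_vector x i = class0 << s >> by exact: dsum_in_id.
have yj : point_vector y j = zmap H (connect1 h) (class0 << s >>).
  by rewrite zmap_H0_point; exact: dsum_in_id.
have nji := zedge_asym h.
have [jE|iE] : j = i.+1 :> nat \/ i = j.+1 :> nat.
  by case/orP: (zedge_adj h) => /eqP; [left|right].
- exists (point_vector x), (point_vector y); split.
  + by rewrite subrr add0r.
  + apply: out; rewrite -val_eqE /=; move: ip jp; rewrite /in_interval; lia.
  + apply: out; rewrite -val_eqE /=; move: ip jp; rewrite /in_interval; lia.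
  + move=> a b h' ap bp; split=> ab.
      have [ai|ai] := eqVneq i a.
        subst a; have bj : b = j by apply: val_inj => /=; lia.
        by subst b; rewrite xi yj; exact: zmap_edge.
      rewrite !out ?linear0 //; apply: contra ai => /eqP /= jb.
      apply/eqP/val_inj => /=.
      by have := congr1 val jb => /=; lia.
    have [ja|ja] := eqVneq j a.
      subst a; have bi : b = i by apply: val_inj => /=; lia.
      by subst b; rewrite h' in nji.
    rewrite !out ?linear0 //; apply: contra ja => /eqP /= ib.
    apply/eqP/val_inj => /=.
    by have := congr1 val ib => /=; lia.
- have outN (z : point) l : tag z != l -> (- point_vector z) l = 0.
    by move=> zl; rewrite -[LHS]/(- point_vector z l) out ?oppr0.
  exists (- point_vector y), (- point_vector x); split.
  + by rewrite addrAC addNr add0r.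
  + apply: outN; rewrite -val_eqE /=; move: ip jp; rewrite /in_interval; lia.
  + apply: outN; rewrite -val_eqE /=; move: ip jp; rewrite /in_interval; lia.
  + move=> a b h' ap bp; split=> ab.
      have [ja|ja] := eqVneq j a.
        subst a; have bi : b = i by apply: val_inj => /=; lia.
        by subst b; rewrite h' in nji.
      rewrite !outN ?linear0 //; apply: contra ja => /eqP /= ib.
      apply/eqP/val_inj => /=.
      by have := congr1 val ib => /=; lia.
    have [ai|ai] := eqVneq i a.
      subst a; have bj : b = j by apply: val_inj => /=; lia.
      subst b; rewrite -[(- point_vector x) i]/(- point_vector x i).
      rewrite -[RHS]/(- point_vector y j) xi yj [LHS]linearN; congr (- _).
      exact: zmap_edge.
    rewrite !outN ?linear0 //; apply: contra ai => /eqP /= jb.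
    apply/eqP/val_inj => /=.
    by have := congr1 val jb => /=; lia.
Qed.

(** The flow from [x] to [z], with the sink at the right end added back, enters and
leaves every level with the same class, so it is a section. *)
Lemma section_of_linked (x : simplex R (X p.1) 0) (z : simplex R (X p.2) 0) :
  linked (pt x) (pt z) ->
  exists v : forall i, H i, is_section p (M := H) v /\ v p.1 = class0 << x >>.
Proof.
move=> /linked_flow[w [u [uE w0 u0 wu]]].
pose v : dsum (fun i => H i : lmodType k) := w + point_vector (pt z).
have vE : v = u + point_vector (pt x) by rewrite uE addrAC subrK.
have vw l : l != p.2 -> v l = w l.
  move=> lp; rewrite -[LHS]/(w l + point_vector (pt z) l).
  by rewrite /point_vector dsum_in_neq ?addr0 // eq_sym.
have vu l : l != p.1 -> v l = u l.
  move=> lp; rewrite vE -[LHS]/(u l + point_vector (pt x) l).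
  by rewrite /point_vector dsum_in_neq ?addr0 // eq_sym.
exists v; split; last first.
  rewrite vE -[LHS]/(u p.1 + point_vector (pt x) p.1) u0 add0r.
  exact: dsum_in_id.
move=> i j h ip jp; have [wu1 wu2] := wu i j h ip jp.
have [jE|iE] : j = i.+1 :> nat \/ i = j.+1 :> nat.
  by case/orP: (zedge_adj h) => /eqP; [left|right].
- rewrite vw ?vu ?wu1 //; rewrite -val_eqE /=; move: ip jp; rewrite /in_interval; lia.
- rewrite vu ?vw ?wu2 //; rewrite -val_eqE /=; move: ip jp; rewrite /in_interval; lia.
Qed.

(** The indicator of the component of [x a] pairs to 1 with the flow that starts at
[x a], and to 0 with the other ones. *)
Lemma rank_ge_of_spanning r : spanning_ge r -> rank_ge p H r.
Proof.
move=> [x [z [xz xx]]].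
have [v vP] := choice (fun a => section_of_linked (xz a)).
exists v, (fun a => component_form (pt (x a))); split; [|split].
- by move=> a; have [] := vP a.
- by move=> a; exact: component_form_cosection.
move=> a b; have [_ ->] := vP b; rewrite component_form_point.
congr (nat_of_bool _)%:R.
by apply/asboolP/eqP => [|->]; [exact: xx | exact: linked_refl].
Qed.

Hypothesis p_valid : (p.1 <= p.2)%N.

(** Let [L] contain one point of [X p.1] in each component that meets the supports of
the given sections. As cosections are constant on components, a pairing is a sum
over [K] in [L] of the value of the cosection at [K] times the coefficient of the
section on the component of [K]. This coefficient may be computed at [p.2], hence
is 0 if the component does not reach [p.2]. So the identity matrix factors through
the spanning components. *)
Lemma spanning_of_rank_ge r : rank_ge p H r -> spanning_ge r.
Proof.
move=> [v [phi [vs [ps pv]]]].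
pose S : seq (simplex R (X p.1) 0) :=
  flatten [seq dom (hcycle_val (hrepr (v y p.1))) | y <- enum 'I_r].
have lex (s : simplex R (X p.1) 0) :
  exists s' : simplex R (X p.1) 0, `[< linked (pt s) (pt s') >].
  by exists s; apply/asboolP; exact: linked_refl.
(* A choice that only depends on the class: one point per component. *)
pose rho s : simplex R (X p.1) 0 := xchoose (lex s).
have rhoP s : linked (pt s) (pt (rho s)) by exact/asboolP/(xchooseP (lex s)).
have rho_eq s s' : linked (pt s) (pt s') -> rho s = rho s'.
  move=> ss; apply: eq_xchoose => z; apply/asboolP/asboolP => zz.
    exact: linked_trans (linked_sym ss) zz.
  exact: linked_trans ss zz.
pose L := undup (map rho S).
pose K (j : 'I_(size L)) := tnth (in_tuple L) j.
have Kin j : K j \in L by exact: mem_tnth.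
have KE j : rho (K j) = K j.
  have := Kin j; rewrite mem_undup => /mapP[s _ ->].
  by apply/esym/rho_eq/rhoP.
have Kinj j j' : linked (pt (K j)) (pt (K j')) -> j = j'.
  move=> /rho_eq; rewrite !KE => E; apply/val_inj/eqP => /=.
  have x0 := K j; move/eqP: E; rewrite /K !(tnth_nth x0) /=.
  by rewrite nth_uniq ?undup_uniq.
pose span j := `[< exists z : simplex R (X p.2) 0, linked (pt (K j)) (pt z) >].
have p1_in : in_interval p p.1 by rewrite /in_interval leqnn.
have p2_in : in_interval p p.2 by rewrite /in_interval leqnn andbT.
have le : (r <= #|span|)%N.
  apply: (card_ge_of_factorization (A := fun x j => phi x p.1 (class0 << K j >>))
    (B := fun j y => component_form (pt (K j)) p.1 (v y p.1))) => x y.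
  have nspan j : ~~ span j -> component_form (pt (K j)) p.1 (v y p.1) = 0.
    move=> /asboolPn ns.
    rewrite (pairing_const (vs y) (component_form_cosection _) p1_in p2_in).
    move: (v y p.2); apply: homology_ind => [|a s u u0]; first exact: linear0.
    rewrite linearP u0 addr0 component_form_point.
    by case: asboolP => [ls|_]; [case: ns; exists s | rewrite scaler0].
  rewrite -pv.
  transitivity (\sum_j phi x p.1 (class0 << K j >>) *
                       component_form (pt (K j)) p.1 (v y p.1)).
    rewrite [LHS]big_mkcond; apply: eq_bigr => j _.
    by case: ifP => // /negbT /nspan ->; rewrite mulr0.
  set c := hcycle_val (hrepr (v y p.1)).
  have vE : v y p.1 = \sum_(s <- dom c) coeff s c *: class0 << s >>.
    by rewrite -class0_sum class0_repr.
  have formE (g : {linear H p.1 -> k^o}) :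
      g (v y p.1) = \sum_(s <- dom c) coeff s c * g (class0 << s >>) :> k.
    by rewrite vE linear_sum; apply: eq_bigr => s _; rewrite linearZ_LR.
  rewrite formE; under eq_bigr do rewrite formE mulr_sumr.
  rewrite exchange_big /= big_seq [RHS]big_seq; apply: eq_bigr => s sc.
  have sS : s \in S.
    by apply/flattenP; exists (dom c) => //; apply: map_f; rewrite mem_enum.
  have rs : rho s \in L by rewrite mem_undup map_f.
  have ri : (index (rho s) L < size L)%N by rewrite index_mem.
  have Kr : K (Ordinal ri) = rho s by rewrite /K (tnth_nth (rho s)) /= nth_index.
  have Ks : linked (pt (K (Ordinal ri))) (pt s) by rewrite Kr; exact/linked_sym/rhoP.
  rewrite (bigD1 (Ordinal ri)) // big1 => [|j ji].
    rewrite [point_form _ _](component_form_point (pt (K _)) s) (asboolT Ks).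
    rewrite mulr1 [LHS]addr0 mulrC; congr (_ * _).
    exact: (cosection_linked (ps x) Ks).
  rewrite [point_form _ _](component_form_point (pt (K _)) s) asboolF ?mulr0 // => js.
  by case/eqP: ji; apply: Kinj; exact: linked_trans js (linked_sym Ks).
pose f (a : 'I_r) := enum_val (widen_ord le a).
have finj : injective f by move=> a b /enum_val_inj /(congr1 val) /= /val_inj.
have fz a : exists z : simplex R (X p.2) 0, linked (pt (K (f a))) (pt z).
  by apply/asboolP; exact: (enum_valP (widen_ord le a)).
have [z zP] := choice fz.
exists (fun a => K (f a)), z; split=> // a b /Kinj; exact: finj.
Qed.

End Linked.

(** * Independence of the field *)

(** The bars of [s1] that contain [p] give components that span [p], and these give
bars of [s2]. *)
Lemma interval_decomposition_count_le (R : realType) (n : nat) (T : zigzag n)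
    (X : top_diagram R T) (k1 k2 : fieldType) s1 s2
    (p : 'I_n * 'I_n) :
  interval_decomposition (H0 X k1) s1 -> interval_decomposition (H0 X k2) s2 ->
  (p.1 <= p.2)%N -> (count (covers p) s1 <= count (covers p) s2)%N.
Proof.
move=> [_ iso1] [_ iso2] pv; rewrite -!card_tnth.
apply: (rank_ge_zzsum_le pv); apply/(rank_ge_zziso p _ iso2).
apply: rank_ge_of_spanning; apply: spanning_of_rank_ge => //.
apply/(rank_ge_zziso p _ iso1); exact: rank_ge_zzsum.
Qed.

Lemma interval_decomposition_perm_eq (R : realType) (n : nat) (T : zigzag n)
    (X : top_diagram R T) (k1 k2 : fieldType) s1 s2 :
  interval_decomposition (H0 X k1) s1 -> interval_decomposition (H0 X k2) s2 ->
  perm_eq s1 s2.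
Proof.
move=> d1 d2; apply: perm_eq_of_covers; [exact: d1.1 | exact: d2.1 |].
move=> p pv; apply/anti_leq/andP; split.
  exact: interval_decomposition_count_le d1 d2 pv.
exact: interval_decomposition_count_le d2 d1 pv.
Qed.

Theorem theorem3p1 (R : realType) (n : nat) (T : zigzag n)
    (X : top_diagram R T) (k1 k2 : fieldType) :
  Bar (H0 X k1) = Bar (H0 X k2).
Proof.
apply/eq_seq_msetP; apply: (interval_decomposition_perm_eq (X := X)).
- exact: xgetPex (interval_decomposition_exists (H0 X k1)).
- exact: xgetPex (interval_decomposition_exists (H0 X k2)).
Qed.
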